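(* Let $k$ be an algebraically closed field of characteristic $2$ and $t$ transcendental over $k$. For any $N\in\mathbb N$ there is a nonempty Zariski-open subset $H$ of $\mathrm{Rat}_2(k)$ such that $\operatorname{Gal}(\varphi^N(x)-t/k(t))\cong[S_2]^N$ for every $\varphi\in H$.
   Context: $\mathrm{Rat}_d(k)$ is the set of $(a_0,\dots,a_d,b_0,\dots,b_d)\in\mathbb A^{2d+2}(k)$ such that, with $p=a_dx^d+\dots+a_0$, $q=b_dx^d+\dots+b_0$, the resultant of $p,q$ is nonzero and $a_d$ or $b_d$ is nonzero; it is identified with degree-$d$ rational functions $\varphi=p/q$ and carries the subspace Zariski topology. $\varphi^N$ is $N$-fold composition; $\operatorname{Gal}(\varphi^N(x)-t/k(t))$ is the Galois group of the splitting field over $k(t)$ of $P(x)-tQ(x)$ where $\varphi^N=P/Q$. $[S_2]^N$ is the $N$-th wreath power of $S_2$ (automorphism group of the binary rooted tree to level $N$). *)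

(* Defs.v *)
From HB Require Import structures.
From mathcomp Require Import all_boot all_order all_algebra all_fingroup all_field.
From mathcomp Require mpoly.
Set Implicit Arguments. Unset Strict Implicit. Unset Printing Implicit Defensive.
Import Order.TTheory GRing.Theory.
Local Open Scope ring_scope.

(* A point of A^6(k) is a function 'I_6 -> k, read as
   (a_0, a_1, a_2, b_0, b_1, b_2):  a_i = v i, b_i = v (3 + i). *)
Section Rat2.
Variable k : fieldType.
Implicit Types v : 'I_6 -> k.

Definition coef_a v (i : nat) : k := if (i < 3)%N then v (inord i) else 0.
Definition coef_b v (i : nat) : k := if (i < 3)%N then v (inord (3 + i)) else 0.

Definition num_poly v : {poly k} := \poly_(i < 3) coef_a v i.
Definition den_poly v : {poly k} := \poly_(i < 3) coef_b v i.

(* The degree-(2,2) Sylvester matrix of (p, q):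
     [ a2 a1 a0 0 ; 0 a2 a1 a0 ; b2 b1 b0 0 ; 0 b2 b1 b0 ] *)
Definition sylv22 v : 'M[k]_4 :=
  \matrix_(i < 4, j < 4)
    if (i < 2)%N then
      (if (i <= j <= i + 2)%N then coef_a v (2 - (j - i)) else 0)
    else
      (if (i - 2 <= j <= i)%N then coef_b v (2 - (j - (i - 2))) else 0).

Definition res22 v : k := \det (sylv22 v).

Definition inRat2 v : Prop :=
  res22 v != 0 /\ (coef_a v 2 != 0 \/ coef_b v 2 != 0).

(* Zariski-open subsets of A^6(k): complements of the common zero locus of a
   finite family S of polynomials in 6 variables.  The open subset of
   Rat_2(k) (subspace topology) attached to S is Rat_2(k) ∩ D(S). *)
Definition in_open (S : seq (mpoly.mpoly 6 k)) v : Prop :=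
  has (fun f => mpoly.meval v f != 0) S.

(* Homogeneous iteration: phi^n = P_n / Q_n with
   P_0 = x, Q_0 = 1,
   P_{n+1} = a2 P_n^2 + a1 P_n Q_n + a0 Q_n^2,
   Q_{n+1} = b2 P_n^2 + b1 P_n Q_n + b0 Q_n^2,
   i.e. phi^{n+1} = phi o phi^n written in lowest terms. *)
Fixpoint iterPQ v (n : nat) : {poly k} * {poly k} :=
  match n with
  | 0 => ('X, 1)
  | n.+1 =>
      let (P, Q) := iterPQ v n in
      (coef_a v 2 *: (P * P) + coef_a v 1 *: (P * Q) + coef_a v 0 *: (Q * Q),
       coef_b v 2 *: (P * P) + coef_b v 1 *: (P * Q) + coef_b v 0 *: (Q * Q))
  end.

Definition kt := {fraction {poly k}}.

Definition to_kt (p : {poly k}) : {poly kt} := map_poly (fun c => tofrac (c%:P)) p.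
Definition t_kt : kt := tofrac (('X : {poly k})).

Definition iter_minus_t v (N : nat) : {poly kt} :=
  to_kt (iterPQ v N).1 - t_kt *: to_kt (iterPQ v N).2.
End Rat2.

(* [S_2]^N: the automorphism group of the binary rooted tree of depth N,
   realised faithfully on its leaves (N.-tuple bool): permutations of the
   leaves preserving, for every level i, the relation "same ancestor at
   level i" (= equal prefixes of length i). *)
Definition tree_aut (N : nat) : {set {perm N.-tuple bool}} :=
  [set s : {perm N.-tuple bool} | [forall u : N.-tuple bool, forall v : N.-tuple bool, forall i : 'I_N.+1,
      (take i u == take i v) == (take i (s u) == take i (s v))]].

Lemma tree_aut_group_set N : group_set (tree_aut N).
Proof.
apply/group_setP; split.
  by rewrite inE; apply/forallP=> u; apply/forallP=> v; apply/forallP=> i;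
     rewrite !perm1.
move=> s t; rewrite !inE => /forallP Hs /forallP Ht.
apply/forallP=> u; apply/forallP=> v; apply/forallP=> i.
rewrite !permM.
move: (forallP (Hs u) v) => /forallP /(_ i) /eqP ->.
by move: (forallP (Ht (s u)) (s v)) => /forallP /(_ i) /eqP ->.
Qed.

Canonical tree_aut_group N := Group (tree_aut_group_set N).

(* Main.v *)
(* Write [phi = p/q], with critical value [c = a_1/b_1].  In characteristic 2 the
   derivative of [phi] has a single zero [g], and [phi y = x] becomes, after a
   Moebius change of the variable [y], the Artin-Schreier equation
   [Z^2 + Z = d/(x - c) + const].  Hence the preimages of [t] form a binary tree
   on which the Galois group acts, and the two children of [x] are exchanged
   exactly when [Z] is changed by [1].
   The automorphism group [W] of the tree is a 2-group all of whose homomorphisms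
   to [Z/2] are sums of the [N] level signs, so a subgroup that is not killed by
   any nonempty sum of level signs is [W] (Frattini).  The sign at level [i]
   describes the Galois action on [Z_i], the sum over the vertices [x] of level
   [i] of the value of [Z] at a child of [x], and
   [Z_i^2 + Z_i = const + B_i/(t - phi^i(c))] with [B_i] nonzero as soon as [c]
   is not periodic.  If the first points of the orbit of [c] are finite and
   distinct, a nonempty sum of these elements of [k(t)] has a simple pole, hence
   is not of the form [h^2 + h].  These conditions on the critical orbit are open,
   and they hold for [(s x^2 + x + 1)/x] with [s] general. *)

Require Import Defs.
From HB Require Import structures.
From mathcomp Require Import all_boot all_order all_algebra all_fingroup all_solvable all_field.
From mathcomp Require Import ring zify.
From mathcomp Require Import mpoly.
Set Implicit Arguments. Unset Strict Implicit. Unset Printing Implicit Defensive.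
Import GRing.Theory.

(** * Automorphisms of the binary tree *)

Section BinaryTree.
Variable N : nat.
Local Notation leaf := (N.-tuple bool).
Implicit Types (u v : leaf) (g h : {perm leaf}) (f : seq bool -> bool).

Lemma leaf_eqP u v :
  (forall i, i < N -> nth false u i = nth false v i) -> u = v.
Proof. by move=> H; apply/val_inj/(@eq_from_nth _ false); rewrite !size_tuple. Qed.

Lemma take_eqP u v i : i <= N ->
  reflect (forall j, j < i -> nth false u j = nth false v j)
          (take i u == take i v).
Proof.
move=> iN; apply: (iffP eqP) => [E j ji|H].
  by rewrite -(nth_take false ji u) E nth_take.
apply: (@eq_from_nth _ false) => [|j]; rewrite !size_takel ?size_tuple // => ji.
by rewrite !nth_take // H.
Qed.

Lemma tree_autP g :
  reflect (forall u v i, i <= N ->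
             (take i u == take i v) = (take i (g u) == take i (g v)))
          (g \in tree_aut N).
Proof.
rewrite inE; apply: (iffP forallP) => [H u v i iN|H u].
  have /forallP/(_ v)/forallP/(_ (Ordinal (n := N.+1) (m := i) iN)) := H u.
  by move/eqP.
by apply/forallP=> v; apply/forallP=> -[i /= iN]; apply/eqP/H.
Qed.

Lemma tree_aut_involution g :
    involutive g ->
    (forall u v i, i <= N -> take i u = take i v -> take i (g u) = take i (g v)) ->
  g \in tree_aut N.
Proof.
move=> gK Hg; apply/tree_autP=> u v i iN.
apply/eqP/eqP; first exact: Hg.
by move/(Hg _ _ _ iN); rewrite !gK.
Qed.

(** A leaf is a path from the root whose entry [j] is the turn taken at level [j]. Changing entry
    [i] exchanges the two subtrees below the vertex [take i u]. *)
Definition flip_fun i f u : leaf :=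
  [tuple nth false u j (+) ((j == i :> nat) && f (take i u)) | j < N].

Lemma nth_flip_fun i f u j : j < N ->
  nth false (flip_fun i f u) j = nth false u j (+) ((j == i) && f (take i u)).
Proof. by move=> jN; rewrite -[j]/(val (Ordinal jN)) nth_mktuple. Qed.

Lemma take_flip_fun i f u : i <= N -> take i (flip_fun i f u) = take i u.
Proof.
move=> iN; apply/eqP/take_eqP => // j ji.
by rewrite nth_flip_fun ?(leq_trans ji) // ltn_eqF // addbF.
Qed.

Lemma flip_funK i f : i <= N -> involutive (flip_fun i f).
Proof.
move=> iN u; apply: leaf_eqP => j jN.
by rewrite !nth_flip_fun // take_flip_fun // addbK.
Qed.

Lemma flip_fun_inj i f : injective (flip_fun (minn i N) f).
Proof. exact/can_inj/flip_funK/geq_minr. Qed.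

(* The level is truncated at [N] so that [flip] is total; levels [>= N] are
   never used. *)
Definition flip i f : {perm leaf} := perm (@flip_fun_inj i f).

Lemma flipE i f u : i <= N -> flip i f u = flip_fun i f u.
Proof. by move=> iN; rewrite permE (minn_idPl iN). Qed.

Lemma flip_tree_aut i f : i <= N -> flip i f \in tree_aut N.
Proof.
move=> iN; apply: tree_aut_involution => [u|u v j jN /eqP/take_eqP E].
  by rewrite !flipE // flip_funK.
rewrite !flipE //; apply/eqP/take_eqP => // l lj.
rewrite !nth_flip_fun ?(leq_trans lj) // E //; congr (_ (+) _).
have [li|//] := eqVneq l i; congr f; apply/eqP/take_eqP => // l' ll'.
by apply: E => //; apply: ltn_trans ll' _; rewrite -li.
Qed.

(** Translations act transitively on the vertices of each level; turns past the end of [c] are left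
    alone. *)
Definition shift_fun (c : seq bool) u : leaf :=
  [tuple nth false u j (+) nth false c j | j < N].

Lemma nth_shift_fun c u j : j < N ->
  nth false (shift_fun c u) j = nth false u j (+) nth false c j.
Proof. by move=> jN; rewrite -[j]/(val (Ordinal jN)) nth_mktuple. Qed.

Lemma shift_funK c : involutive (shift_fun c).
Proof. by move=> u; apply: leaf_eqP => j jN; rewrite !nth_shift_fun // addbK. Qed.

Definition shift c : {perm leaf} := perm (can_inj (shift_funK c)).

Lemma shift_tree_aut c : shift c \in tree_aut N.
Proof.
apply: tree_aut_involution => [u|u v i iN /eqP/take_eqP E].
  by rewrite !permE shift_funK.
rewrite !permE; apply/eqP/take_eqP => // j ji.
by rewrite !nth_shift_fun ?(leq_trans ji) // E.
Qed.

(** The translation by [w] is an involution exchanging [w] with the leftmost vertex of its level, so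
    it conjugates the two one-vertex flips. *)
Lemma flip_single_conj i (w : i.-tuple bool) : i <= N ->
  flip i (pred1 (val w)) =
  (shift w * flip i (pred1 (nseq i false)) * shift w)%g.
Proof.
move=> iN; apply/permP => u; rewrite !permM !flipE // !permE.
apply: leaf_eqP => j jN.
rewrite nth_shift_fun // !nth_flip_fun // nth_shift_fun //.
rewrite addbAC addbK; congr (_ (+) (_ && _)).
have p1 (a x : seq bool) : pred1 a x = (x == a) by [].
rewrite !p1; apply/eqP/eqP => [E|E].
  apply: (@eq_from_nth _ false) => [|l]; rewrite ?size_takel ?size_tuple ?size_nseq // => li.
  have lN := leq_trans li iN.
  by rewrite nth_take // nth_nseq li nth_shift_fun // -E nth_take // addbb.
apply: (@eq_from_nth _ false) => [|l]; rewrite ?size_takel ?size_tuple ?size_nseq // => li.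
have lN := leq_trans li iN.
have := congr1 (fun s => nth false s l) E.
rewrite nth_take // nth_nseq li nth_shift_fun // nth_take //.
by do 2 case: nth.
Qed.

Lemma flip_xor i f1 f2 : i <= N ->
  flip i (fun s => f1 s (+) f2 s) = (flip i f1 * flip i f2)%g.
Proof.
move=> iN; apply/permP => u; rewrite permM !flipE //.
apply: leaf_eqP => j jN.
rewrite !nth_flip_fun // take_flip_fun // -addbA.
by case: (j == i).
Qed.

Lemma eq_flip i f1 f2 : i <= N ->
  (forall w : i.-tuple bool, f1 w = f2 w) -> flip i f1 = flip i f2.
Proof.
move=> iN E; apply/permP => u; rewrite !flipE //.
apply: leaf_eqP => j jN; rewrite !nth_flip_fun //.
have st : size (take i u) == i by rewrite size_takel // size_tuple.
by rewrite (E (Tuple st)).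
Qed.

Definition pad (w : seq bool) : leaf := [tuple nth false w j | j < N].

Lemma nth_pad w j : j < N -> nth false (pad w) j = nth false w j.
Proof. by move=> jN; rewrite -[j]/(val (Ordinal jN)) nth_mktuple. Qed.

Lemma take_pad w : size w <= N -> take (size w) (pad w) = w.
Proof.
move=> wN; apply: (@eq_from_nth _ false); rewrite size_takel ?size_tuple // => j jw.
by rewrite nth_take // nth_pad // (leq_trans jw).
Qed.

(** The portrait of [g]: as [pad] continues [w] with [false], this bit tells which child the [false]
    child of [w] is sent to. *)
Definition label g (w : seq bool) : bool := nth false (g (pad w)) (size w).

(** The leaves [u] and [pad (take i u)] share their first [i] turns, and so do their images. They
    share one more exactly when their images do, which determines a two-valued turn. *)
Lemma nth_tree_aut g u i : g \in tree_aut N -> i < N ->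
  nth false (g u) i = nth false u i (+) label g (take i u).
Proof.
move=> /tree_autP Wg iN; rewrite /label; have iN' := ltnW iN.
have st : size (take i u) = i by rewrite size_takel // size_tuple ltnW.
have E j : j < i -> nth false u j = nth false (pad (take i u)) j.
  by move=> ji; rewrite nth_pad ?(ltn_trans ji) // nth_take.
have F : nth false (pad (take i u)) i = false by rewrite nth_pad // nth_default // st.
have P : forall j, j < i -> nth false (g u) j = nth false (g (pad (take i u))) j.
  by apply/(take_eqP _ _ iN'); rewrite -Wg //; apply/(take_eqP _ _ iN').
have ext b1 b2 (x y : leaf) : nth false x i = b1 -> nth false y i = b2 ->
   (forall j, j < i -> nth false x j = nth false y j) ->
   (take i.+1 x == take i.+1 y) = (b1 == b2).
  move=> xb yb xy; apply/take_eqP/eqP => // [/(_ i (ltnSn i))|b12 j].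
    by rewrite xb yb.
  by rewrite ltnS leq_eqVlt => /orP[/eqP->|/xy//]; rewrite xb yb.
rewrite st; have := Wg u (pad (take i u)) i.+1 iN.
rewrite (ext _ _ _ _ erefl F E) (ext _ _ _ _ erefl erefl P).
by do 3 case: nth.
Qed.

(** The flips are composed from the lowest level upwards, so that each one still reads the original
    prefix of the leaf. *)
Lemma tree_aut_prod_flips g m : g \in tree_aut N -> m <= N ->
  exists2 h, h = (\prod_(i < m) flip (N - i.+1) (label g))%g &
  forall u j, j < N ->
   nth false (h u) j = if j < N - m then nth false u j else nth false (g u) j.
Proof.
move=> Wg; elim: m => [_|m IH mN]; first rewrite big_ord0.
  by exists 1%g => // u j jN; rewrite subn0 jN perm1.
have [h Dh Hh] := IH (ltnW mN).
exists (h * flip (N - m.+1) (label g))%g; first by rewrite big_ord_recr /= Dh.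
move=> u j jN; have lN : N - m.+1 < N by rewrite ltn_subrL /= (leq_ltn_trans _ jN).
have sE : N - m = (N - m.+1).+1 by rewrite subnSK.
rewrite permM flipE ?leq_subr // nth_flip_fun // Hh // sE ltnS.
have [->|ne] := eqVneq j (N - m.+1).
  rewrite leqnn ltnn /= (nth_tree_aut _ Wg lN); congr (_ (+) label _ _).
  apply/eqP/take_eqP => [|l lj]; first exact: leq_subr.
  by rewrite (Hh _ _ (ltn_trans lj lN)) sE ltnS (ltnW lj).
by rewrite addbF [j <= _]leq_eqVlt (negPf ne).
Qed.

(** * Homomorphisms from the tree group to Z/2 *)

Section Character.
Variable chi : {perm leaf} -> bool.
Hypothesis chiM : {in tree_aut N &, forall g h, chi (g * h)%g = chi g (+) chi h}.

Definition chi_level i := chi (flip i (pred1 (nseq i false))).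

Lemma chi1 : chi 1%g = false.
Proof. by have := chiM (group1 _) (group1 _); rewrite mulg1; case: chi. Qed.

(** A flip of level [i] is a product of one-vertex flips, which are conjugate and hence have the
    same value under [chi]. *)
Lemma chi_flip i f : i <= N ->
  chi (flip i f) = chi_level i && \big[addb/false]_(w : i.-tuple bool) f w.
Proof.
move=> iN.
have single (w : i.-tuple bool) : chi (flip i (pred1 (val w))) = chi_level i.
  rewrite flip_single_conj // !chiM ?groupM ?shift_tree_aut ?flip_tree_aut //.
  by rewrite addbC addbA addbb.
have gen (s : seq (i.-tuple bool)) : uniq s ->
    chi (flip i (fun x => f x && (x \in map val s))) =
    chi_level i && \big[addb/false]_(w <- s) f w.
  elim: s => [_|w s IH /= /andP[ws /IH {}IH]].
    rewrite big_nil andbF -[RHS]chi1; congr chi.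
    by apply/permP=> u; rewrite flipE // perm1; apply: leaf_eqP => j jN;
       rewrite nth_flip_fun // andbF andbF addbF.
  rewrite big_cons -(@eq_flip _
    (fun x => (f w && pred1 (val w) x) (+) (f x && (x \in map val s)))) //.
    rewrite flip_xor // chiM ?flip_tree_aut // IH.
    rewrite andb_addr; congr (_ (+) _).
    case: (f w); first by rewrite andbT single.
    rewrite andbF -[RHS]chi1; congr chi.
    by apply/permP=> u; rewrite flipE // perm1; apply: leaf_eqP => j jN;
       rewrite nth_flip_fun //= andbF addbF.
  move=> x /=; rewrite inE.
  have [E|_] := eqVneq (val x) (val w); last by rewrite andbF.
  by rewrite E mem_map ?(negPf ws) ?andbF ?andbT ?addbF //; apply: val_inj.
rewrite -big_enum /= -gen ?enum_uniq //; congr chi; apply: eq_flip => // w.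
by rewrite mem_map ?mem_enum ?inE ?andbT //; apply: val_inj.
Qed.

(** Apply [chi] to the decomposition of [g] into one flip per level: every homomorphism to Z/2 is a
    sum of level signs. *)
Lemma chi_label g : g \in tree_aut N ->
  chi g = \big[addb/false]_(i < N)
     (chi_level i && \big[addb/false]_(w : i.-tuple bool) label g w).
Proof.
move=> Wg; have [h Dh Hh] := tree_aut_prod_flips Wg (leqnn N).
have -> : g = h by apply/permP => u; apply: leaf_eqP => j jN; rewrite Hh // subnn.
have P m : m <= N -> chi (\prod_(i < m) flip (N - i.+1) (label g))%g =
   \big[addb/false]_(i < m) chi (flip (N - i.+1) (label g)).
  elim: m => [_|m IH mN]; first by rewrite !big_ord0 chi1.
  rewrite !big_ord_recr /= chiM ?flip_tree_aut ?leq_subr //; first by rewrite IH // ltnW.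
  by apply: group_prod => i _; apply: flip_tree_aut; apply: leq_subr.
rewrite {1}Dh P // [RHS](reindex_inj rev_ord_inj) /=; apply: eq_bigr => i _.
have -> : h = g by apply/permP => u; apply: leaf_eqP => j jN; rewrite Hh // subnn.
by rewrite chi_flip ?leq_subr.
Qed.

End Character.

(** The exponent divides [2 ^ N]: if [h] fixes level [m] pointwise, then [h * h] adds the same label
    twice to turn [m] and fixes level [m.+1]. *)
Lemma tree_aut_2group : (2.-group (tree_aut N))%g.
Proof.
rewrite -pnat_exponent; apply: (@pnat_dvd _ (2 ^ N)); last by rewrite pnatX pnat_id.
apply/exponentP => g Wg; apply/permP => u; rewrite perm1.
suff H m : m <= N -> forall v, take m ((g ^+ (2 ^ m))%g v) = take m v.
  by have := H N (leqnn N) u; rewrite !take_oversize ?size_tuple // => /val_inj.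
elim: m {u} => [|m IH] mN v; first by rewrite !take0.
have WX n : (g ^+ n)%g \in tree_aut N by rewrite groupX.
set h := (g ^+ (2 ^ m))%g.
have -> : (g ^+ (2 ^ m.+1))%g = (h * h)%g by rewrite expnS mul2n -addnn expgD.
have E x : take m (h x) = take m x by apply: IH; rewrite ltnW.
rewrite permM; apply/eqP/take_eqP => // j; rewrite ltnS leq_eqVlt => /orP[/eqP->|jm].
  by rewrite !(nth_tree_aut _ (WX _)) // E addbK.
by rewrite -[RHS](nth_take _ jm) -E -E nth_take.
Qed.

(* Every maximal subgroup has index 2, and its sign character is a nonzero
   combination of the level signs because all one-vertex flips of a given
   level are conjugate. *)
Lemma proper_subgroup_level_signs (H : {group {perm leaf}}) :
  H \proper tree_aut N ->
  exists2 J : pred 'I_N, (exists i, J i) &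
  forall g, g \in H ->
    \big[addb/false]_(i < N)
     (J i && \big[addb/false]_(w : i.-tuple bool) label g w) = false.
Proof.
move=> /andP[sHW nsWH].
have [eHW|[M maxM sHM]] := @maximal_exists _ H (tree_aut_group N) sHW.
  by rewrite eHW subxx in nsWH.
have iM := p_maximal_index tree_aut_2group maxM.
have sMW : M \subset tree_aut N := proper_sub (maxgroupp maxM).
pose chi g := g \notin M.
have cardW : #|tree_aut N :\: M| = #|M|.
  apply: (@addnI #|M|); rewrite -{1}(setIidPr sMW) cardsID addnn -muln2 -iM.
  by rewrite Lagrange.
have chiM : {in tree_aut N &, forall g h, chi (g * h)%g = chi g (+) chi h}.
  move=> g h Wg Wh; rewrite /chi.
  have [Mg|nMg] /= := boolP (g \in M); first by rewrite groupMl.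
  have [Mh|nMh] /= := boolP (h \in M); first by rewrite groupMr // nMg.
  apply/negbTE; rewrite negbK.
  have : h \in (g^-1 *: M)%g; last by rewrite mem_lcoset invgK.
  suff -> : (g^-1 *: M)%g = tree_aut N :\: M by rewrite inE nMh.
  apply/eqP; rewrite eqEcard cardW card_lcoset leqnn andbT.
  apply/subsetP => x; rewrite mem_lcoset invgK inE => Mgx; apply/andP; split.
    by apply: contra nMg => Mx; rewrite -(groupMr _ Mx).
  by rewrite -(groupMl _ Wg) (subsetP sMW).
exists (fun i => chi_level chi i); last first.
  move=> g Hg; rewrite -chi_label ?(subsetP sHW) //.
  by rewrite /chi (subsetP sHM).
apply/existsP; apply: contraT; rewrite negb_exists => /forallP J0.
case/negP: (proper_subn (maxgroupp maxM)); apply/subsetP => g Wg.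
apply/negPn; rewrite -/(chi g) (chi_label chiM) // big1 // => i _.
by rewrite (negPf (J0 i)).
Qed.

End BinaryTree.

Local Open Scope ring_scope.

(** * Homogeneous iteration of quadratic maps *)

Section QuadraticStep.
Variable R : comNzRingType.
Implicit Types (w : 'I_6 -> R) (x : R * R).

(** The map on homogeneous coordinates, over any commutative ring, so that points, polynomials and
    indeterminate coefficients can be compared along ring morphisms. *)
Definition qstep w x : R * R :=
  (w (inord 2) * x.1 ^+ 2 + w (inord 1) * (x.1 * x.2) + w (inord 0) * x.2 ^+ 2,
   w (inord 5) * x.1 ^+ 2 + w (inord 4) * (x.1 * x.2) + w (inord 3) * x.2 ^+ 2).

Lemma qstepZ w a x : qstep w (a * x.1, a * x.2) =
  (a ^+ 2 * (qstep w x).1, a ^+ 2 * (qstep w x).2).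
Proof. by rewrite /qstep /=; congr (_, _); ring. Qed.

End QuadraticStep.

Lemma qstep_morph (R S : comNzRingType) (h : {rmorphism R -> S})
    (w : 'I_6 -> R) (x : R * R) :
  qstep (h \o w) (h x.1, h x.2) = (h (qstep w x).1, h (qstep w x).2).
Proof. by rewrite /qstep /= !expr2 !rmorphD !rmorphM. Qed.

Lemma iter_qstep_morph (R S : comNzRingType) (h : {rmorphism R -> S})
    (w : 'I_6 -> R) n (x : R * R) :
  iter n (qstep (h \o w)) (h x.1, h x.2) =
  (h (iter n (qstep w) x).1, h (iter n (qstep w) x).2).
Proof. by elim: n => //= n ->; rewrite qstep_morph. Qed.

Lemma iterPQE (k : fieldType) (v : 'I_6 -> k) n :
  iterPQ v n = iter n (qstep (polyC \o v)) ('X, 1).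
Proof.
elim: n => //= n ->; case: (iter n _ _) => P Q.
by rewrite /qstep /coef_a /coef_b /= -!mul_polyC !expr2 !mulrA.
Qed.

Section Resultant.
Variables (k : fieldType) (v : 'I_6 -> k).
Hypothesis res_neq0 : res22 v != 0.

(** The Sylvester matrix sends the column of cubic monomials to [x p], [y p], [x q], [y q], where
    [p] and [q] are the homogeneous forms. If both vanish, its invertibility forces
    [x ^ 3 = y ^ 3 = 0]. *)
Lemma qstep_eq0 (x : k * k) : qstep v x = (0, 0) -> x = (0, 0).
Proof.
case: x => x y [] /= E1 E2.
pose c : 'cV[k]_4 := \col_i (x ^+ (3 - i) * y ^+ i).
have Sc : sylv22 v *m c = 0.
  apply/colP => i; rewrite !mxE !big_ord_recl big_ord0 !mxE /bump /=.
  have E1' z := etrans (congr1 ( *%R z) E1) (mulr0 z).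
  have E2' z := etrans (congr1 ( *%R z) E2) (mulr0 z).
  by case: i => -[|[|[|[|//]]]] /= _; rewrite /coef_a /coef_b /bump /=
    ?(leq0n, addn0, add1n, subSS, subn0, subnn, addSn, add0n);
    [apply: etrans (E1' x) | apply: etrans (E1' y)
    | apply: etrans (E2' x) | apply: etrans (E2' y)]; ring.
have c0 : c = 0.
  have uS : sylv22 v \in unitmx by rewrite unitmxE unitfE.
  by rewrite -[c](mulKmx uS) Sc mulmx0.
have := congr1 (fun M : 'cV_4 => M (inord 0) 0) c0.
have := congr1 (fun M : 'cV_4 => M (inord 3) 0) c0.
rewrite !mxE !inordK //= mul1r mulr1 => /eqP; rewrite expf_eq0 /= => /eqP ->.
by move/eqP; rewrite expf_eq0 /= => /eqP ->.
Qed.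

Lemma iter_qstep_eq0 n x : iter n (qstep v) x = (0, 0) -> x = (0, 0).
Proof. by elim: n => //= n IH /qstep_eq0. Qed.

End Resultant.

Lemma coefM_top (k : nzRingType) (p q : {poly k}) d e :
  (size p <= d.+1)%N -> (size q <= e.+1)%N ->
  (p * q)`_(d + e) = p`_d * q`_e.
Proof.
move=> sp sq; rewrite coefM (bigD1 (inord d)) //= inordK ?ltnS ?leq_addr //.
rewrite addKn big1 ?addr0 // => i ne.
have {}ne : i != d :> nat.
  by apply: contraNneq ne => E; apply/eqP/val_inj; rewrite /= inordK // ltnS leq_addr.
case: (ltngtP i d) ne => // [id|di] _.
  by rewrite [q`__]nth_default ?mulr0 // (leq_trans sq) // ltn_subRL ltn_add2r.
by rewrite [p`__]nth_default ?mul0r // (leq_trans sp).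
Qed.

(** The coefficients of degree [2 ^ n] follow the orbit of the point at infinity [(1, 0)]. *)
Lemma iter_qstep_poly (k : fieldType) (v : 'I_6 -> k) n :
  let P := iter n (qstep (polyC \o v)) ('X, 1) in
  [/\ (size P.1 <= (2 ^ n).+1)%N, (size P.2 <= (2 ^ n).+1)%N &
      (P.1`_(2 ^ n), P.2`_(2 ^ n)) = iter n (qstep v) (1, 0)].
Proof.
elim: n => [|n]; first by rewrite /= size_polyX size_poly1 coefX coef1.
rewrite /=; case: (iter n _ ('X, 1)) => P Q /= [sP sQ E].
have sM (A B : {poly k}) : (size A <= (2 ^ n).+1)%N -> (size B <= (2 ^ n).+1)%N ->
    (size (A * B)%R <= (2 ^ n.+1).+1)%N.
  move=> sA sB; apply: leq_trans (size_polyMleq _ _) _.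
  rewrite -subn1 leq_subLR add1n expnS mul2n -addnn -addSn -addnS.
  exact: leq_add.
have sL (a b c : k) (A B C : {poly k}) :
    (size A <= (2 ^ n.+1).+1)%N -> (size B <= (2 ^ n.+1).+1)%N ->
    (size C <= (2 ^ n.+1).+1)%N ->
    (size (a%:P * A + b%:P * B + c%:P * C)%R <= (2 ^ n.+1).+1)%N.
  move=> sA sB sC; rewrite !mul_polyC.
  have sZ (c0 : k) (D : {poly k}) :
    (size D <= (2 ^ n.+1).+1)%N -> (size (c0 *: D)%R <= (2 ^ n.+1).+1)%N.
    by apply: leq_trans; apply: size_scale_leq.
  apply: leq_trans (size_polyD _ _) _; rewrite geq_max sZ // andbT.
  by apply: leq_trans (size_polyD _ _) _; rewrite geq_max !sZ.
rewrite -E; split; try by apply: sL; rewrite ?expr2; apply: sM.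
rewrite /qstep /= !coefD !coefCM !expr2 expnS mul2n -addnn.
by rewrite !coefM_top.
Qed.

Lemma eq_qstep (R : comNzRingType) (w1 w2 : 'I_6 -> R) :
  w1 =1 w2 -> qstep w1 =1 qstep w2.
Proof. by move=> E x; rewrite /qstep !E. Qed.

(** Modulo [D] the starting point is [V] times [(x, 1)], so by homogeneity its iterates are
    multiples of those of [(x, 1)]. *)
Lemma iter_qstep_congr (R : comNzRingType) (w : 'I_6 -> R) (D V x : R) j :
  exists s A B, iter j (qstep w) (x * V + D, V) =
    (s * (iter j (qstep w) (x, 1)).1 + D * A,
     s * (iter j (qstep w) (x, 1)).2 + D * B).
Proof.
elim: j => [|j [s [A [B /= ->]]]]; first by exists V, 1, 0; congr (_, _) => /=; ring.
case: (iter j _ _) => P Q; rewrite /qstep /=.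
pose G a b c := a * (s * P * A *+ 2 + D * A ^+ 2) + b * (s * P * B + s * A * Q + D * A * B)
  + c * (s * Q * B *+ 2 + D * B ^+ 2).
exists (s ^+ 2), (G (w (inord 2)) (w (inord 1)) (w (inord 0))).
exists (G (w (inord 5)) (w (inord 4)) (w (inord 3))).
by rewrite /G; congr (_, _); ring.
Qed.

(** * A quadratic map expanded at its critical point *)

Section NormalForm.
Variable F : fieldType.
Variables c e g m b1 b2 : F.
Implicit Types y a : F.

(** In the application [g] is the critical point, [c] the critical value, and [m * b1] the value of
    the denominator at [g]. *)
Definition nden y := m * b1 + b1 * (y - g) + b2 * (y - g) ^+ 2.
Definition nphi y := c + e * (y - g) ^+ 2 / nden y.
Definition nZ y := m / (y - g).
(** The other preimage of [nphi y]: the Moebius involution taking [nZ y] to [- 1 - nZ y], the second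
    root of [Z ^+ 2 + Z = const]. *)
Definition nsib y := g - m * (y - g) / (m + (y - g)).

Hypotheses (e0 : e != 0) (m0 : m != 0) (b10 : b1 != 0).

(* With [Z = m / (y - g)] the equation [nphi y = x] reads
   [Z ^+ 2 + Z = d / (x - c) + const]: an Artin-Schreier equation. *)
Lemma nZ_artin_schreier y : y - g != 0 -> nden y != 0 ->
  nZ y ^+ 2 + nZ y = m * e / b1 / (nphi y - c) - m * b2 / b1.
Proof.
rewrite /nZ /nphi /nden; set Y := y - g => Y0 d0.
by rewrite addrAC subrr add0r; field; rewrite e0 b10 d0 Y0.
Qed.

Section Sibling.
Variable y : F.
Hypotheses (Y0 : y - g != 0) (mY0 : m + (y - g) != 0) (d0 : nden y != 0).

Let sibE : nsib y - g = - (m * (y - g) / (m + (y - g))).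
Proof. by rewrite /nsib addrAC subrr add0r. Qed.

Lemma nZ_sib : nZ (nsib y) = - 1 - nZ y.
Proof.
rewrite /nZ sibE; move: (y - g) Y0 mY0 => Y H1 H2.
by field; rewrite H1 H2 oppr_eq0 mulf_neq0.
Qed.

Lemma nden_sib : nden (nsib y) = m ^+ 2 * nden y / (m + (y - g)) ^+ 2.
Proof. by rewrite /nden sibE; move: (y - g) mY0 => Y ?; field. Qed.

Lemma nphi_sib : nphi (nsib y) = nphi y.
Proof.
rewrite /nphi nden_sib sibE; move: (y - g) (nden y) mY0 d0 => Y d ? ?.
by field; apply/and3P.
Qed.

(** With [x = nphi y], the left side is minus the logarithmic derivative at [a] of [f = p - x q],
    where [nphi = p / q]. In characteristic 2 the derivative of [f] is the constant [b1 (c - x)],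
    while [f(a) = nden a * (nphi a - x)]. *)
Lemma nsib_sum_inv a : 2%:R = 0 :> F -> y != a -> nsib y != a -> nden a != 0 ->
  nphi y != nphi a ->
  (y - a)^-1 + (nsib y - a)^-1 =
  b1 / nden a * (1 + (nphi a - c) / (nphi y - nphi a)).
Proof.
move=> two0; rewrite -subr_eq0 => ya sa da; rewrite -subr_eq0.
have -> : y - a = (y - g) - (a - g) by ring.
have {sa} : (nsib y - g) - (a - g) != 0 by move: sa; rewrite -subr_eq0; congr (_ != _); ring.
have -> : nsib y - a = (nsib y - g) - (a - g) by ring.
rewrite sibE; have {ya} : (y - g) - (a - g) != 0 by move: ya; congr (_ != _); ring.
move: da d0; rewrite /nphi /nden; move: (a - g) (y - g) Y0 mY0 => A Y Y0' mY0' da dy YA.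
(* Up to sign, [D] is the numerator of [nsib y - a]. By [K] below, the numerator of
   [nphi y - nphi a] is [b1] times those of [y - a] and [nsib y - a], multiplied by [e]. *)
pose D := m * Y + A * m + A * Y.
have -> : - (m * Y / (m + Y)) - A = - D / (m + Y) by rewrite /D; field.
rewrite mulf_eq0 invr_eq0 (negPf mY0') orbF oppr_eq0 => D0.
have K : Y ^+ 2 * (m * b1 + b1 * A + b2 * A ^+ 2) - A ^+ 2 * (m * b1 + b1 * Y + b2 * Y ^+ 2)
  = b1 * (Y - A) * D by rewrite /D; ring.
move: K da dy; set dA := m * b1 + b1 * A + _; set dY := m * b1 + b1 * Y + _ => K da dy _.
have -> : c + e * Y ^+ 2 / dY - (c + e * A ^+ 2 / dA) =
  e * (b1 * (Y - A) * D) / (dY * dA) by rewrite -K; field; rewrite da dy.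
have {K} -> : 1 + (c + e * A ^+ 2 / dA - c) / (e * (b1 * (Y - A) * D) / (dY * dA)) =
   Y ^+ 2 * dA / (b1 * (Y - A) * D).
  have -> : Y ^+ 2 * dA = b1 * (Y - A) * D + A ^+ 2 * dY by rewrite -K; ring.
  by field; rewrite da dy D0 YA b10 e0.
(* The multiple of 2 is kept explicit, so that the identity holds in every characteristic until
   [two0] removes it. *)
have -> : (Y - A)^-1 + (- D / (m + Y))^-1 =
   Y ^+ 2 / ((Y - A) * D) + 2%:R * (A * (m + Y) - Y ^+ 2) / ((Y - A) * D).
  have -> : 2%:R * (A * (m + Y) - Y ^+ 2) = D - (m + Y) * (Y - A) - Y ^+ 2.
    by rewrite /D; ring.
  by field; rewrite D0 YA mY0' oppr_eq0 D0.
by rewrite two0 !mul0r addr0; field; rewrite da D0 YA b10.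
Qed.

End Sibling.
End NormalForm.

(** * The tree of preimages *)

Section NormalFormExists.
Variables (k : closedFieldType) (v : 'I_6 -> k).
Hypothesis two0 : 2%:R = 0 :> k.
Hypothesis res_neq0 : res22 v != 0.
Hypothesis b1_neq0 : v (inord 4) != 0.
Hypothesis det_neq0 : v (inord 2) * v (inord 4) != v (inord 1) * v (inord 5).

(** Subtracting [c = a_1 / b_1] times the denominator removes the linear term of the numerator. What
    remains, [e y ^ 2] plus a constant, is [e (y - g) ^ 2] in characteristic 2 for a suitable square
    root [g] in [k]. *)
Lemma normal_form_exists : exists c e g m b1 b2 : k,
  [/\ e != 0, m != 0, b1 != 0, c = v (inord 1) / v (inord 4) &
  forall (F : fieldType) (h : {rmorphism k -> F}) y,
    let x := qstep (h \o v) (y, 1) in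
    x.2 = nden (h g) (h m) (h b1) (h b2) y /\
    x.1 = h c * x.2 + h e * (y - h g) ^+ 2].
Proof.
have [a2 H2] : exists x, v (inord 2) = x by eexists.
have [a1 H1] : exists x, v (inord 1) = x by eexists.
have [a0 H0] : exists x, v (inord 0) = x by eexists.
have [b2 H5] : exists x, v (inord 5) = x by eexists.
have [b1 H4] : exists x, v (inord 4) = x by eexists.
have [b0 H3] : exists x, v (inord 3) = x by eexists.
have := det_neq0; have := b1_neq0; rewrite H1 H2 H4 H5 => b10 det0.
pose c := a1 / b1; pose e := a2 - c * b2.
have e0 : e != 0.
  apply: contraNneq det0 => E; rewrite -subr_eq0.
  apply/eqP; transitivity (e * b1); last by rewrite E mul0r.
  by rewrite /e /c; field.
have [g /eqP Dg] : exists g, g ^+ 2 == (a0 - c * b0) / e.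
  have /closed_rootP[g] : size ('X^2 - ((a0 - c * b0) / e)%:P) != 1%N.
    by rewrite size_XnsubC.
  by rewrite /root !hornerE subr_eq0 => ?; exists g.
have {}Dg : a0 = c * b0 + e * g ^+ 2 by rewrite Dg; field.
have Da1 : a1 = c * b1 by rewrite /c; field.
have Da2 : a2 = c * b2 + e by rewrite /e; ring.
have Dc : c = a1 / b1 by []; clearbody e; clearbody c.
pose m := (b2 * g ^+ 2 + b1 * g + b0) / b1.
have Dm : m * b1 = b2 * g ^+ 2 + b1 * g + b0 by rewrite /m; field.
exists c, e, g, m, b1, b2; split=> //.
  (* If [m = 0], then [g] is a common zero of numerator and denominator, against the resultant. *)
  apply: contraTneq (oner_neq0 k) => m0; rewrite negbK.
  have q0 : b2 * g ^+ 2 + b1 * (g * 1) + b0 * 1 ^+ 2 = 0.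
    by rewrite !mulr1 expr1n mulr1 -Dm m0 mul0r.
  suff /(qstep_eq0 res_neq0)[_ ->] : qstep v (g, 1) = (0, 0) by [].
  rewrite /qstep /= H0 H1 H2 H3 H4 H5 q0 Dg Da1 Da2; congr (_, _).
  have -> : (c * b2 + e) * g ^+ 2 + c * b1 * (g * 1) + (c * b0 + e * g ^+ 2) * 1 ^+ 2 =
    c * (b2 * g ^+ 2 + b1 * (g * 1) + b0 * 1 ^+ 2) + 2%:R * (e * g ^+ 2) by ring.
  by rewrite q0 two0 mulr0 mul0r addr0.
move=> F h y /=; have h2 : 2%:R = 0 :> F by rewrite -(rmorph_nat h) two0 rmorph0.
rewrite H0 H1 H2 H3 H4 H5; split.
  rewrite /nden -rmorphM Dm !expr2 !rmorphD !rmorphM /=.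
  apply/eqP; rewrite -subr_eq0; apply/eqP.
  transitivity (2%:R * (h b2 * h g * y - h b2 * h g ^+ 2)); first by ring.
  by rewrite h2 mul0r.
rewrite Dg Da1 Da2 !expr2 !rmorphD !rmorphM /=.
apply/eqP; rewrite -subr_eq0; apply/eqP.
transitivity (2%:R * (h e * h g * y)); first by ring.
by rewrite h2 mul0r.
Qed.

End NormalFormExists.

Lemma big_tuple_rcons (R : nmodType) n (F : seq bool -> R) :
  \sum_(w : n.+1.-tuple bool) F w =
  \sum_(w : n.-tuple bool) (F (rcons w false) + F (rcons w true)).
Proof.
pose r (p : n.-tuple bool * bool) : n.+1.-tuple bool := [tuple of rcons p.1 p.2].
have r_inj : injective r.
  by move=> [w b] [w' b'] /(congr1 val) /= /rcons_inj[/val_inj -> ->].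
rewrite (reindex r) /=; last first.
  by apply/onW_bij/(inj_card_bij r_inj); rewrite card_prod !card_tuple card_bool expnS mulnC.
rewrite -(pair_bigA _ (fun (w : n.-tuple bool) b => F (rcons w b))) /=.
by apply: eq_bigr => w _; rewrite big_bool addrC.
Qed.

Section Tower.
Variables (k : closedFieldType) (L : fieldType) (iota : {rmorphism k -> L}).
Hypothesis two0 : 2%:R = 0 :> k.
Variables c e g m b1 b2 : k.
Hypotheses (e0 : e != 0) (m0 : m != 0) (b10 : b1 != 0).

Local Notation den := (nden (iota g) (iota m) (iota b1) (iota b2)).
Local Notation phi :=
  (nphi (iota c) (iota e) (iota g) (iota m) (iota b1) (iota b2)).
Local Notation Z := (nZ (iota g) (iota m)).
Local Notation sib := (nsib (iota g) (iota m)).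

Definition nonconst (x : L) := forall a, x <> iota a.

Let twoL : 2%:R = 0 :> L. Proof. by rewrite -(rmorph_nat iota) two0 rmorph0. Qed.
Let ie0 : iota e != 0. Proof. by rewrite fmorph_eq0. Qed.
Let im0 : iota m != 0. Proof. by rewrite fmorph_eq0. Qed.
Let ib0 : iota b1 != 0. Proof. by rewrite fmorph_eq0. Qed.

(** A nonzero polynomial splits over [k], so its roots in [L] are constants. Thus [nonconst] means
    transcendental over [k]. *)
Lemma root_nonconst (r : {poly k}) y :
  nonconst y -> root (map_poly iota r) y -> r = 0.
Proof.
move=> ny; have [s Dr] := closed_field_poly_normal r.
apply: contraTeq => r0; rewrite Dr map_polyZ rootZ ?fmorph_eq0 ?lead_coef_eq0 //.
rewrite rmorph_prod /= (eq_bigr (fun a => 'X - (iota a)%:P)) => [|a _].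
  rewrite -(big_map iota xpredT (fun z => 'X - z%:P)) root_prod_XsubC.
  by apply/mapP => -[a _ /ny].
by rewrite rmorphB /= map_polyX map_polyC.
Qed.

Let nsub y a : nonconst y -> y - iota a != 0.
Proof. by move=> ny; rewrite subr_eq0; apply/eqP/ny. Qed.

Let nadd y : nonconst y -> iota m + (y - iota g) != 0.
Proof.
by move/(nsub (g - m)); congr (_ != 0); rewrite rmorphB; ring.
Qed.

Let map_XsubC : map_poly iota ('X - g%:P) = 'X - (iota g)%:P.
Proof. by rewrite rmorphB /= map_polyX map_polyC. Qed.

Let den_poly_exists :
  exists r : {poly k}, r.[g] = m * b1 /\ forall y, (map_poly iota r).[y] = den y.
Proof.
exists ((m * b1)%:P + b1 *: ('X - g%:P) + b2 *: ('X - g%:P) ^+ 2); split.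
  by rewrite !hornerE /= ?expr2 ?subrr ?mulr0 ?addr0.
move=> y; rewrite !rmorphD /= !map_polyZ rmorphXn /= map_XsubC map_polyC /=.
by rewrite /nden !hornerE rmorphM.
Qed.

Lemma nonconst_den y : nonconst y -> den y != 0.
Proof.
move=> ny; have [r [rg rE]] := den_poly_exists.
apply/eqP; rewrite -rE => /eqP/(root_nonconst ny) E.
by move/eqP: rg; rewrite E horner0 eq_sym mulf_eq0 (negPf m0) (negPf b10).
Qed.

(** If [phi y = iota a], then [y] is a root of [(c - a) r + e (X - g) ^ 2], with [r] the
    denominator, so this polynomial is zero. Its value at [g] gives [a = c], and then [e = 0]. *)
Lemma nonconst_phi y : nonconst y -> nonconst (phi y).
Proof.
move=> ny a Da; have dy := nonconst_den ny; have [r [rg rE]] := den_poly_exists.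
have : root (map_poly iota ((c - a) *: r + e *: ('X - g%:P) ^+ 2)) y.
  rewrite rmorphD /= !map_polyZ rmorphXn /= map_XsubC.
  rewrite /root hornerD !hornerZ rE !hornerE rmorphB /= -Da /nphi.
  by apply/eqP; field.
move=> /(root_nonconst ny) E.
have := congr1 (horner^~ g) E.
rewrite hornerD !hornerZ rg !hornerE /= ?expr2 ?subrr ?mulr0 ?addr0.
move/eqP; rewrite !mulf_eq0 (negPf m0) (negPf b10) !orbF subr_eq0 => /eqP ca.
move: E; rewrite ca subrr scale0r add0r => /eqP.
by rewrite scale_poly_eq0 (negPf e0) expf_eq0 polyXsubC_eq0.
Qed.

Let iota_den a : iota (nden g m b1 b2 a) = den (iota a).
Proof. by rewrite /nden !expr2 !(rmorphB, rmorphD, rmorphM). Qed.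

Lemma phi_nonconst y : nonconst (phi y) -> nonconst y.
Proof.
move=> ny a Da; case: (ny (nphi c e g m b1 b2 a)); rewrite Da /nphi.
by rewrite rmorphD fmorph_div iota_den !expr2 !(rmorphB, rmorphM).
Qed.

Lemma nonconst_iter n y : nonconst y -> nonconst (iter n phi y).
Proof. by move=> ny; elim: n => //= n; apply: nonconst_phi. Qed.

Lemma iter_nonconst n y : nonconst (iter n phi y) -> nonconst y.
Proof. by elim: n => //= n IH /phi_nonconst. Qed.

Section Nodes.
Variables (N : nat) (T : L) (pre : L -> L).
Hypothesis T_nonconst : nonconst T.
Hypothesis preP : forall n x, (n < N)%N -> iter n phi x = T -> phi (pre x) = x.

(** Words address the vertices of the tree with root [T]. The labelling depends on the choice [pre]
    of one preimage; [sib] supplies the other. *)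
Definition node (w : seq bool) : L :=
  foldl (fun x (b : bool) => if b then sib (pre x) else pre x) T w.

Lemma node_rcons w b :
  node (rcons w b) = if b then sib (pre (node w)) else pre (node w).
Proof. exact: foldl_rcons. Qed.

Lemma phi_sib y : nonconst y -> phi (sib y) = phi y.
Proof. by move=> ny; apply: nphi_sib => //; [apply: nadd|apply: nonconst_den]. Qed.

Lemma node_iter w : (size w <= N)%N -> iter (size w) phi (node w) = T.
Proof.
elim/last_ind: w => // w b IH; rewrite size_rcons => wN.
have IHw := IH (ltnW wN); have Pp := preP wN IHw.
have np : nonconst (pre (node w)).
  by apply: phi_nonconst; rewrite Pp; apply: (@iter_nonconst (size w)); rewrite IHw.
by rewrite iterSr node_rcons; case: b; rewrite ?phi_sib ?Pp.
Qed.

Lemma node_nonconst w : (size w <= N)%N -> nonconst (node w).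
Proof. by move=> wN; apply: (@iter_nonconst (size w)); rewrite node_iter. Qed.

Lemma node_false_nonconst w : (size w < N)%N -> nonconst (node (rcons w false)).
Proof. by move=> wN; apply: node_nonconst; rewrite size_rcons. Qed.

Lemma node_true w : node (rcons w true) = sib (node (rcons w false)).
Proof. by rewrite !node_rcons. Qed.

Lemma phi_node w b : (size w < N)%N -> phi (node (rcons w b)) = node w.
Proof.
move=> wN; have P : phi (node (rcons w false)) = node w.
  by rewrite node_rcons (preP wN) // node_iter // ltnW.
by case: b => //; rewrite node_true phi_sib //; apply: node_false_nonconst.
Qed.

Lemma node_take w i : (size w <= N)%N -> (i <= size w)%N ->
  iter (size w - i) phi (node w) = node (take i w).
Proof.
elim/last_ind: w => [|w b IH]; first by case: i.
rewrite size_rcons => wN; rewrite leq_eqVlt => /orP[/eqP->|].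
  by rewrite subnn take_oversize ?size_rcons.
rewrite ltnS => iw; rewrite subSn // iterSr phi_node // IH //; last exact: ltnW.
by rewrite -cats1 takel_cat.
Qed.

Lemma Z_node_true w : (size w < N)%N ->
  Z (node (rcons w true)) = Z (node (rcons w false)) + 1.
Proof.
move=> wN; have ny := node_false_nonconst wN.
rewrite node_true nZ_sib ?nsub ?nadd //; set z := Z _.
apply/eqP; rewrite -subr_eq0; apply/eqP.
by transitivity (- (2%:R * (1 + z))); [ring | rewrite twoL mul0r oppr0].
Qed.

(** Applying [phi] shows that the parents agree, which settles all turns but the last; siblings are
    told apart by [Z], whose values differ by 1. *)
Lemma node_inj w w' : size w = size w' -> (size w <= N)%N ->
  node w = node w' -> w = w'.
Proof.
elim/last_ind: w w' => [|w b IH] w'; first by case: w'.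
case/lastP: w' => [|w' b']; rewrite !size_rcons // => -[E] wN D.
have ww' : w = w'.
  by apply: IH => //; [apply: ltnW | rewrite -(phi_node b wN) D phi_node // -E].
clear E; subst w'; congr (rcons _ _).
have := Z_node_true wN; case: b b' D => [] [] // ->; move/eqP.
  by rewrite -[X in X == _]addr0 (inj_eq (addrI _)) eq_sym oner_eq0.
by rewrite -[X in X == _]addr0 (inj_eq (addrI _)) eq_sym oner_eq0.
Qed.

Variable o : nat -> k.
Hypothesis o_den : forall i, (i < N)%N -> den (iota (o i)) != 0.
Hypothesis o_phi : forall i, (i < N)%N -> phi (iota (o i)) = iota (o i.+1).

(** Pairing siblings by [nsib_sum_inv] turns a sum over level [n.+1] at the point [o i] into a sum
    over level [n] at [o i.+1]. Each pass multiplies [B] by a nonzero constant times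
    [o i.+1 - c]. *)
Lemma sum_inv_node n i : (i + n <= N)%N ->
  exists A B : k, \sum_(w : n.-tuple bool) (node w - iota (o i))^-1 =
    iota A + iota B / (T - iota (o (i + n))) /\
  ((forall j, (i < j <= i + n)%N -> o j != c) -> B != 0).
Proof.
elim: n i => [|n IH] i inN.
  exists 0, 1; rewrite addn0 rmorph0 rmorph1 add0r mul1r; split; last by rewrite oner_neq0.
  rewrite (big_pred1 [tuple]) // => w; apply/esym/eqP/val_inj.
  by case: w => -[].
rewrite addnS in inN; have [|A [B [DAB B0]]] := IH i.+1; first by rewrite addSn.
have iN : (i < N)%N by apply: leq_ltn_trans inN; apply: leq_addr.
have nN : (n < N)%N by apply: leq_ltn_trans inN; apply: leq_addl.
pose C := b1 / nden g m b1 b2 (o i).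
have iC : iota C = iota b1 / den (iota (o i)).
  by rewrite /C fmorph_div iota_den.
rewrite (big_tuple_rcons n (fun w => (node w - iota (o i))^-1)).
have S (w : n.-tuple bool) : (node (rcons w false) - iota (o i))^-1 +
    (node (rcons w true) - iota (o i))^-1 =
    iota C + iota (C * (o i.+1 - c)) * (node w - iota (o i.+1))^-1.
  have sw : (size w < N)%N by rewrite size_tuple.
  have ny := node_false_nonconst sw.
  have nsy : nonconst (node (rcons w true)) by apply: node_nonconst; rewrite size_rcons.
  rewrite node_true in nsy *.
  rewrite (nsib_sum_inv (c := iota c) ie0 (b2 := iota b2) ib0)
    ?o_phi ?phi_node ?o_den ?nonconst_den //.
  - by rewrite iC rmorphM rmorphB iC mulrDr mulr1 !mulrA.
  - exact: nsub.
  - exact: nadd.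
  - exact/eqP/ny.
  - exact/eqP/nsy.
  - exact/eqP/node_nonconst/ltnW.
rewrite (eq_bigr _ (fun w _ => S w)) big_split /= -mulr_sumr DAB addSn.
rewrite sumr_const.
exists (C *+ #|{: n.-tuple bool}| + C * (o i.+1 - c) * A), (C * (o i.+1 - c) * B).
split.
  by rewrite addnS rmorphD rmorphMn mulrDr !addrA !rmorphM /= mulrA.
move=> Hc; rewrite !mulf_neq0 ?B0 ?invr_eq0 //.
- by rewrite -(fmorph_eq0 iota) iota_den o_den.
- by rewrite subr_eq0 Hc // ltnSn addnS ltnS leq_addr.
by move=> j /andP[ij jn]; apply: Hc; rewrite addnS jn (ltn_trans _ ij).
Qed.

End Nodes.
End Tower.

(** * Simple poles and Artin-Schreier equations over k(t) *)

Lemma frac_numden (R : idomainType) (x : {fraction R}) :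
  exists u w : R, w != 0 /\ x * tofrac w = tofrac u.
Proof.
elim/quotW: x => r; exists \n_r, \d_r; split; first exact: denom_ratioP.
unlock FracField.tofrac; rewrite -[LHS]FracField.pi_mul; apply/eqmodP.
rewrite /= FracField.equivfE /FracField.mulf.
rewrite !numden_Ratio ?mulf_neq0 ?oner_neq0 ?denom_ratioP //.
by rewrite !mulr1 mulrC.
Qed.

Section ArtinSchreier.
Variable k : fieldType.
Implicit Types (a : k) (u w p q : {poly k}) (x : {fraction {poly k}}).

(* Descent: at [a] the equation forces first [w] and then [u] to vanish, and a
   factor ['X - a%:P] can be cancelled from both. *)
Lemma odd_order_contra a u w p q :
    w != 0 -> p.[a] != 0 -> q.[a] != 0 ->
  u * (u + w) * ('X - a%:P) * p <> w ^+ 2 * q.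
Proof.
move=> w0 pa qa; have [n] := ubnP (size w); elim: n u w w0 => // n IH u w w0 sw E.
have Xa0 : 'X - a%:P != 0 by rewrite polyXsubC_eq0.
have /factor_theorem[w1 Dw] : root w a.
  have /eqP := congr1 (horner^~ a) E.
  rewrite !hornerM hornerXsubC subrr mulr0 mul0r eq_sym !mulf_eq0 (negPf qa) orbF.
  by rewrite orbb.
have {}E : u * (u + w) * p = ('X - a%:P) * w1 ^+ 2 * q.
  by apply: (mulIf Xa0); rewrite -(mulrAC _ _ p) E Dw; ring.
have /factor_theorem[u1 Du] : root u a.
  have /eqP := congr1 (horner^~ a) E; rewrite Dw.
  rewrite !(hornerM, hornerXsubC, hornerD) subrr mulr0 addr0 !mul0r !mulf_eq0.
  by rewrite (negPf pa) orbF orbb.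
have w10 : w1 != 0 by apply: contraNneq w0; rewrite Dw => ->; rewrite mul0r.
apply: (IH u1 w1 w10).
  by move: sw; rewrite Dw size_Mmonic ?monicXsubC // size_XsubC addn2.
by apply: (mulIf Xa0); rewrite -[RHS]mulrAC [w1 ^+ 2 * _]mulrC -E Du Dw; ring.
Qed.

(** Absence of a pole at [a]; the fraction need not be reduced. *)
Definition regular_at a x := exists p q, q.[a] != 0 /\ x * tofrac q = tofrac p.

Lemma regular_atD a x y : regular_at a x -> regular_at a y -> regular_at a (x + y).
Proof.
move=> [p [q [qa E]]] [p' [q' [qa' E']]]; exists (p * q' + p' * q), (q * q').
rewrite hornerM mulf_neq0 //; split=> //.
by rewrite tofracD !tofracM -E -E'; ring.
Qed.

Lemma regular_at_const a b : regular_at a (tofrac b%:P).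
Proof. by exists b%:P, 1; rewrite hornerC oner_neq0 tofrac1 mulr1. Qed.

Lemma regular_at_pole a b b' : a != b ->
  regular_at a (tofrac b'%:P / (tofrac 'X - tofrac b%:P)).
Proof.
move=> ab; exists b'%:P, ('X - b%:P); rewrite hornerXsubC subr_eq0 ab; split=> //.
by rewrite -tofracB mulfVK // tofrac_eq0 polyXsubC_eq0.
Qed.

(** A pole of [h ^+ 2 + h] has even order. Clearing the denominators of [h = u / w] and [x = p / q]
    gives the equation excluded by [odd_order_contra]; its last factor takes the value [b q(a)] at
    [a]. *)
Lemma artin_schreier_simple_pole a b x h : b != 0 -> regular_at a x ->
  h ^+ 2 + h <> tofrac b%:P / (tofrac 'X - tofrac a%:P) + x.
Proof.
move=> b0 [p [q [qa Ex]]] E; have [u [w [w0 Eh]]] := frac_numden h.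
have Xa0 : tofrac 'X - tofrac a%:P != 0 :> {fraction {poly k}}.
  by rewrite -tofracB tofrac_eq0 polyXsubC_eq0.
apply: (@odd_order_contra a u w q (b%:P * q + p * ('X - a%:P))) => //.
  by rewrite !hornerE subrr mulr0 addr0 mulf_neq0.
apply/eqP; rewrite -tofrac_eq; apply/eqP.
rewrite !expr2 !(tofracM, tofracB, tofracD) -!expr2 -Eh -Ex.
transitivity ((h ^+ 2 + h) * tofrac w ^+ 2 * (tofrac 'X - tofrac a%:P) * tofrac q);
  first by ring.
have clear_pole (F : fieldType) (X B W Q y : F) :
  X != 0 -> (B / X + y) * W ^+ 2 * X * Q = W ^+ 2 * (B * Q + y * Q * X).
  by move=> X0; field.
by rewrite E clear_pole // ?expr2.
Qed.

End ArtinSchreier.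

(** * Degree and zeros of the numerator of [phi^n - x] *)

Section Iterates.
Variables (k : closedFieldType) (L : fieldType) (iota : {rmorphism k -> L}).
Variables (v : 'I_6 -> k) (c e g m b1 b2 : k).
Hypotheses (e0 : e != 0) (m0 : m != 0) (b10 : b1 != 0).
Hypothesis res_neq0 : res22 v != 0.

Local Notation den := (nden (iota g) (iota m) (iota b1) (iota b2)).
Local Notation phi :=
  (nphi (iota c) (iota e) (iota g) (iota m) (iota b1) (iota b2)).
Local Notation nonconst := (nonconst iota).

Hypothesis qstep_normal : forall y, let x := qstep (iota \o v) (y, 1) in
   x.2 = den y /\ x.1 = iota c * x.2 + iota e * (y - iota g) ^+ 2.

Lemma qstep_phi y : den y != 0 ->
  qstep (iota \o v) (y, 1) = (phi y * den y, den y).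
Proof.
move=> dy; case: (qstep_normal y); case: (qstep _ _) => A B /= -> ->.
by congr (_, _); rewrite /nphi; field.
Qed.

Lemma iter_qstep_phi n y : nonconst y ->
  let x := iter n (qstep (iota \o v)) (y, 1) in
  x.2 != 0 /\ x.1 = iter n phi y * x.2.
Proof.
move=> ny; elim: n => [|n]; first by rewrite /= oner_neq0 mulr1.
rewrite iterS; set X := iter n _ (y, 1) => -[B0 EA].
have dn : den (iter n phi y) != 0 by apply/nonconst_den/nonconst_iter.
have -> : X = (X.2 * iter n phi y, X.2 * 1).
  by rewrite mulr1 mulrC -EA; case: (X).
rewrite (qstepZ _ _ (iter n phi y, 1 : L)) qstep_phi //= mulf_neq0 ?expf_neq0 //; split=> //; ring.
Qed.

Definition iter_minus n (x : L) : {poly L} :=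
  map_poly iota (iterPQ v n).1 - x *: map_poly iota (iterPQ v n).2.

Lemma map_iterPQ n : let P := iterPQ v n in
  (map_poly iota P.1, map_poly iota P.2) =
  iter n (qstep (polyC \o (iota \o v))) ('X, 1).
Proof.
rewrite /= iterPQE; have := iter_qstep_morph (map_poly iota) (polyC \o v) n ('X, 1).
rewrite /= map_polyX rmorph1 => <-; apply: eq_iter; apply: eq_qstep => i /=.
exact: map_polyC.
Qed.

Lemma horner_iterPQ n y : let P := iterPQ v n in
  ((map_poly iota P.1).[y], (map_poly iota P.2).[y]) =
  iter n (qstep (iota \o v)) (y, 1).
Proof.
have := map_iterPQ n; rewrite /=; case: iterPQ => P Q /= E.
have := iter_qstep_morph (horner_eval y) (polyC \o (iota \o v)) n ('X, 1).
rewrite -E /= /horner_eval hornerX hornerC => <-; apply: eq_iter; apply: eq_qstep => i /=.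
by rewrite hornerC.
Qed.

Lemma root_iter_minus n x y : nonconst y ->
  root (iter_minus n x) y = (iter n phi y == x).
Proof.
move=> ny; have [] := iter_qstep_phi n ny; rewrite -horner_iterPQ /= => Q0 E.
rewrite /root /iter_minus hornerD hornerN hornerZ E -mulrBl mulf_eq0 (negPf Q0) orbF.
exact: subr_eq0.
Qed.

(** A constant [y] has constant iterates [A], [B], so [x] would be the constant [A / B]; and [B = 0]
    would force [A = 0], against the resultant. *)
Lemma root_iter_minus_nonconst n x y :
  nonconst x -> root (iter_minus n x) y -> nonconst y.
Proof.
move=> nx + a Dy; have := horner_iterPQ n y; rewrite Dy.
have := iter_qstep_morph iota v n (a, 1); rewrite /= rmorph1 => ->.
rewrite /root /iter_minus hornerD hornerN hornerZ => -[-> ->].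
set A := _.1; set B := _.2; rewrite subr_eq0 => /eqP Ex.
have [B0|B0] := eqVneq B 0.
  move: Ex; rewrite B0 rmorph0 mulr0 => /eqP; rewrite fmorph_eq0 => /eqP A0.
  have : iter n (qstep v) (a, 1) = (A, B) by rewrite /A /B -surjective_pairing.
  by rewrite A0 B0 => /(iter_qstep_eq0 res_neq0)[_ /eqP]; rewrite oner_eq0.
by case: (nx (A / B)); rewrite fmorph_div Ex mulfK ?fmorph_eq0.
Qed.

(** The two coefficients of degree [2 ^ n] are not both zero, and they can cancel only if [x] is
    their ratio, a constant. *)
Lemma size_iter_minus n x : nonconst x -> size (iter_minus n x) = (2 ^ n).+1.
Proof.
move=> nx; have := iter_qstep_poly v n; rewrite -iterPQE /iter_minus.
case: (iterPQ v n) => P Q /= [sP sQ E].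
apply/eqP; rewrite eqn_leq; apply/andP; split.
  apply: leq_trans (size_polyD _ _) _; rewrite geq_max size_polyN size_map_poly sP /=.
  by apply: leq_trans (size_scale_leq _ _) _; rewrite size_map_poly.
rewrite ltnNge; apply/negP => /leq_sizeP/(_ _ (leqnn _))/eqP.
rewrite coefB coefZ !coef_map /= subr_eq0 => /eqP Ex.
have [Q0|Q0] := eqVneq (Q`_(2 ^ n)) 0.
  move: Ex; rewrite Q0 rmorph0 mulr0 => /eqP; rewrite fmorph_eq0 => /eqP P0.
  move: E; rewrite P0 Q0 => /esym/(iter_qstep_eq0 res_neq0)[/eqP].
  by rewrite oner_eq0.
by case: (nx (P`_(2 ^ n) / Q`_(2 ^ n))); rewrite fmorph_div Ex mulfK ?fmorph_eq0.
Qed.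

(** Solutions of [phi^n y = x] solve [phi^(j+n) y = T]. Multiplicities are covered by iterating the
    pair [(x V + D, V)] modulo the divisor [D]. *)
Lemma iter_minus_dvd n j x T : nonconst x -> iter j phi x = T ->
  (iter_minus n x %| iter_minus (j + n) T)%R.
Proof.
move=> nx Ex; have [B0 EAB] := iter_qstep_phi j nx.
rewrite /iter_minus; have := map_iterPQ (j + n); have := map_iterPQ n.
case: (iterPQ v n) => U V; case: (iterPQ v (j + n)) => P Q /= E.
rewrite iterD -E; set U' := map_poly iota U; set V' := map_poly iota V.
set P' := map_poly iota P; set Q' := map_poly iota Q.
have [s [A [B]]] := iter_qstep_congr (polyC \o (iota \o v)) (U' - x *: V') V' x%:P j.
have := iter_qstep_morph polyC (iota \o v) j (x, 1); rewrite /= => ->.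
rewrite EAB Ex mul_polyC [x *: V' + _]addrC subrK => -> [-> ->] /=.
set D := U' - _; set b := _.2.
have -> : s * (T * b)%:P + D * A - T *: (s * b%:P + D * B) = D * (A - T *: B).
  by rewrite -!mul_polyC polyCM; ring.
exact: dvdp_mulr.
Qed.

End Iterates.

(** * Genericity of the critical orbit *)

Section Genericity.
Variable N : nat.

(** The orbit of the critical value [a_1 / b_1], kept homogeneous so that it is polynomial in the
    coefficients. *)
Definition crit_orbit (R : comNzRingType) (w : 'I_6 -> R) n : R * R :=
  iter n (qstep w) (w (inord 1), w (inord 4)).

(** In characteristic 2 the first factor is, up to sign, the leading coefficient of the Wronskian:
    the critical point is finite. The other two say that the critical value and its first [N] images
    are finite and distinct. *)
Definition generic (R : comNzRingType) (w : 'I_6 -> R) : R :=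
  (w (inord 2) * w (inord 4) - w (inord 1) * w (inord 5)) *
  (\prod_(i < N.+1) (crit_orbit w i).2) *
  \prod_(j < N.+1) \prod_(i < j)
    ((crit_orbit w i).1 * (crit_orbit w j).2 - (crit_orbit w j).1 * (crit_orbit w i).2).

Lemma crit_orbitS (R : comNzRingType) (w : 'I_6 -> R) n :
  crit_orbit w n.+1 = qstep w (crit_orbit w n).
Proof. by []. Qed.

Lemma eq_crit_orbit (R : comNzRingType) (w1 w2 : 'I_6 -> R) n :
  w1 =1 w2 -> crit_orbit w1 n = crit_orbit w2 n.
Proof. by move=> E; rewrite /crit_orbit !E; apply/eq_iter/eq_qstep. Qed.

Lemma eq_generic (R : comNzRingType) (w1 w2 : 'I_6 -> R) :
  w1 =1 w2 -> generic w1 = generic w2.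
Proof.
move=> E; rewrite /generic !E; congr (_ * _ * _).
  by apply: eq_bigr => i _; rewrite (eq_crit_orbit _ E).
by apply: eq_bigr => j _; apply: eq_bigr => i _; rewrite !(eq_crit_orbit _ E).
Qed.

Lemma generic_morph (R S : comNzRingType) (h : {rmorphism R -> S}) (w : 'I_6 -> R) :
  generic (h \o w) = h (generic w).
Proof.
have C n : crit_orbit (h \o w) n = (h (crit_orbit w n).1, h (crit_orbit w n).2).
  exact: (iter_qstep_morph h w n (w (inord 1), w (inord 4))).
rewrite /generic !rmorphM rmorphB !rmorphM /= !rmorph_prod; congr (_ * _ * _).
  by apply: eq_bigr => i _; rewrite C.
apply: eq_bigr => j _; rewrite rmorph_prod; apply: eq_bigr => i _.
by rewrite !C rmorphB !rmorphM.
Qed.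

Definition generic_mpoly (k : fieldType) : mpoly 6 k := generic (fun i => 'X_i).

Lemma meval_generic (k : fieldType) (v : 'I_6 -> k) :
  meval v (generic_mpoly k) = generic v.
Proof.
rewrite /generic_mpoly -generic_morph; apply: eq_generic => i /=.
exact: mevalXU.
Qed.

Lemma generic_neq0 (k : fieldType) (v : 'I_6 -> k) : generic v != 0 ->
  [/\ v (inord 2) * v (inord 4) != v (inord 1) * v (inord 5),
    forall i, (i <= N)%N -> (crit_orbit v i).2 != 0 &
    forall i j, (i < j <= N)%N ->
     (crit_orbit v i).1 / (crit_orbit v i).2 != (crit_orbit v j).1 / (crit_orbit v j).2].
Proof.
rewrite /generic !mulf_eq0 !negb_or subr_eq0.
move=> /andP[/andP[A /prodf_neq0 B] /prodf_neq0 C].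
have D i : (i <= N)%N -> (crit_orbit v i).2 != 0.
  by move=> iN; apply: (B (Ordinal (n := N.+1) (m := i) iN)).
split=> // i j /andP[ij jN].
have /prodf_neq0/(_ (Ordinal ij) isT) := C (Ordinal (n := N.+1) (m := j) jN) isT.
by rewrite /= eqr_div ?D ?(leq_trans (ltnW ij)) // subr_eq0.
Qed.

(* The family [(s x^2 + x + 1) / x], with critical value [1]: the degree in
   [s] of the [n]-th point of the critical orbit is [n]. *)
Definition example (R : comNzRingType) (s : R) (i : 'I_6) : R :=
  nth 0 [:: 1; 1; s; 0; 1; 0] i.

Lemma qstep_example (R : comNzRingType) (s : R) x :
  qstep (example s) x = (s * x.1 ^+ 2 + x.1 * x.2 + x.2 ^+ 2, x.1 * x.2).
Proof. by rewrite /qstep /example !inordK //=; congr (_, _); ring. Qed.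

(** The term [s P ^ 2] dominates the new numerator, so the new difference of degrees is
    [2 deg P + 1 - (deg P + deg Q)], one more than the old one. *)
Lemma size_crit_orbit_example (k : fieldType) n :
  let C := crit_orbit (example ('X : {poly k})) n in
  C.2 != 0 /\ size C.1 = (size C.2 + n)%N.
Proof.
elim: n => [|n].
  by rewrite /crit_orbit /= /example !inordK //= oner_neq0 addn0.
rewrite crit_orbitS qstep_example; case: (crit_orbit _ n) => P Q /= [Q0 sP].
have P0 : P != 0 by rewrite -size_poly_gt0 sP ltn_addr // size_poly_gt0.
have sQ : (0 < size Q)%N by rewrite size_poly_gt0.
have sX : size ('X * P ^+ 2) = (size P).*2.
  rewrite mulrC size_mulX ?expf_neq0 // expr2 size_mul // prednK ?addnn //.
  by rewrite double_gt0 size_poly_gt0.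
split; first by rewrite mulf_neq0.
have sPQ : size (P * Q) = (size P + size Q).-1 by rewrite size_mul.
have sQQ : size (Q ^+ 2) = (size Q + size Q).-1 by rewrite expr2 size_mul.
have lt1 : (size (P * Q)%R < size ('X * P ^+ 2)%R)%N.
  by rewrite sX sPQ sP; move: sQ; move: (size Q) => q; clear; lia.
have sD : size ('X * P ^+ 2 + P * Q) = (size P).*2 by rewrite size_polyDl.
rewrite size_polyDl sD ?sPQ ?sQQ sP; move: sQ; move: (size Q) => q; clear; lia.
Qed.

Lemma generic_example_neq0 (k : fieldType) : generic (example ('X : {poly k})) != 0.
Proof.
rewrite /generic !mulf_neq0 //.
- by rewrite /example !inordK //= mulr0 subr0 mulr1 polyX_eq0.
- by apply/prodf_neq0 => i _; have [] := size_crit_orbit_example k i.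
apply/prodf_neq0 => j _; apply/prodf_neq0 => i _; rewrite subr_eq0.
have := size_crit_orbit_example k i; have := size_crit_orbit_example k j.
case: (crit_orbit _ i) => Ci Di; case: (crit_orbit _ j) => Cj Dj /= [Qj Pj] [Qi Pi].
have nz a (p q : {poly k}) : q != 0 -> size p = (size q + a)%N -> p != 0.
  by move=> q0 E; rewrite -size_poly_gt0 E ltn_addr // size_poly_gt0.
apply/eqP => /(congr1 (fun p : {poly k} => size p)).
rewrite !size_mul ?(nz _ _ _ Qi Pi) ?(nz _ _ _ Qj Pj) // Pi Pj.
move: Qi Qj; rewrite -!size_poly_gt0; move: (ltn_ord i).
move: (size Di) (size Dj) => x y; clear; lia.
Qed.

End Genericity.

(** * The Galois action *)

Lemma root_dvd_prod_XsubC (F : fieldType) (p : {poly F}) rs :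
  (p %| \prod_(z <- rs) ('X - z%:P))%R -> (1 < size p)%N ->
  exists2 r, r \in rs & root p r.
Proof.
move=> /dvdp_prod_XsubC[m Ep] sp.
have : (0 < size (mask m rs))%N.
  by rewrite (eqp_size Ep) size_prod_XsubC ltnS in sp.
case Em : (mask m rs) => [//|r s] _; exists r.
  by apply: (@mem_mask _ _ m); rewrite Em mem_head.
by rewrite (eqp_root Ep) root_prod_XsubC Em mem_head.
Qed.

Section FunctionFieldTower.
Local Notation tofrac := (@FracField.tofrac _).
Variables (k : closedFieldType) (N : nat) (v : 'I_6 -> k).
Variables (L : splittingFieldType (kt k)) (E : {subfield L}).
Hypothesis two0 : 2%:R = 0 :> k.
Hypothesis res_neq0 : res22 v != 0.
Hypothesis v_generic : generic N v != 0.
Hypothesis splitE : splittingFieldFor 1%VS (map_poly (in_alg L) (iter_minus_t v N)) E.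

Variables (iota : {rmorphism k -> L}) (T : L).
Hypothesis iotaE : forall a, iota a = in_alg L (tofrac a%:P).
Hypothesis TE : T = in_alg L (t_kt k).

Lemma iter_minus_tE :
  map_poly (in_alg L) (iter_minus_t v N) = iter_minus iota v N T.
Proof.
have mapE (p : {poly k}) : map_poly (in_alg L) (to_kt p) = map_poly iota p.
  by rewrite -map_poly_comp; apply: eq_map_poly => a /=; rewrite iotaE.
by rewrite /iter_minus_t /iter_minus rmorphB /= map_polyZ !mapE TE.
Qed.

Lemma T_nonconst : nonconst iota T.
Proof.
move=> a; rewrite iotaE TE => /fmorph_inj/eqP; rewrite /t_kt tofrac_eq.
move/eqP => /(congr1 (fun p : {poly k} => size p)).
by rewrite size_polyX size_polyC; case: eqP.
Qed.

Section Normalized.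
Variables c e g m b1 b2 : k.
Hypotheses (e0 : e != 0) (m0 : m != 0) (b10 : b1 != 0).
Hypothesis c_crit : c = v (inord 1) / v (inord 4).

Local Notation den := (nden (iota g) (iota m) (iota b1) (iota b2)).
Local Notation phi :=
  (nphi (iota c) (iota e) (iota g) (iota m) (iota b1) (iota b2)).
Local Notation Z := (nZ (iota g) (iota m)).

Hypothesis qstep_normal : forall y, let x := qstep (iota \o v) (y, 1) in
   x.2 = den y /\ x.1 = iota c * x.2 + iota e * (y - iota g) ^+ 2.

Let twoL : 2%:R = 0 :> L. Proof. by rewrite -(rmorph_nat iota) two0 rmorph0. Qed.

Let o i := (crit_orbit v i).1 / (crit_orbit v i).2.

Let o0 : o 0 = c. Proof. by rewrite c_crit. Qed.

Let o_inj i j : (i < j <= N)%N -> o i != o j.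
Proof. by have [_ _] := generic_neq0 v_generic; apply. Qed.

Let o_step i : (i < N)%N ->
  den (iota (o i)) != 0 /\ phi (iota (o i)) = iota (o i.+1).
Proof.
move=> iN; have [_ D _] := generic_neq0 v_generic.
have Di := D i (ltnW iN); have := D i.+1 iN.
have CE : crit_orbit v i =
    ((crit_orbit v i).2 * (o i, 1 : k).1, (crit_orbit v i).2 * (o i, 1 : k).2).
  by rewrite /= mulr1 mulrC /o divfK // -surjective_pairing.
have qE : qstep (iota \o v) (iota (o i), 1) =
    (iota (qstep v (o i, 1)).1, iota (qstep v (o i, 1)).2).
  by rewrite -qstep_morph /= rmorph1.
have oS : o i.+1 = (qstep v (o i, 1)).1 / (qstep v (o i, 1)).2.
  rewrite {1}/o crit_orbitS CE qstepZ; case: (qstep v (o i, 1)) => q1 q2 /=.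
  by rewrite -mulf_div divff ?mul1r // expf_neq0.
rewrite crit_orbitS CE qstepZ; case: (qstep v (o i, 1)) qE oS => q1 q2 qE oS /=.
rewrite mulf_eq0 negb_or => /andP[_ Q0].
have [dE _] := qstep_normal (iota (o i)).
have d0 : den (iota (o i)) != 0 by rewrite -dE qE fmorph_eq0.
split=> //; have := qstep_phi qstep_normal d0; rewrite qE /= => -[E1 E2].
by rewrite oS [RHS]fmorph_div /= E1 E2 mulfK.
Qed.

Let preimage_nonconst n y : iter n phi y = T -> nonconst iota y.
Proof. by move=> yT; have := T_nonconst; rewrite -yT; apply: iter_nonconst. Qed.

Section Roots.
Variable rs : seq L.
Hypothesis rsP : map_poly (in_alg L) (iter_minus_t v N) %= \prod_(z <- rs) ('X - z%:P).
Hypothesis rsE : <<1 & rs>>%VS = E.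

(** Every vertex below the root of the tree is an iterate of a root of the full polynomial, so
    preimages are searched in a finite list. Exponents below [N] suffice, since [T] is not looked
    for. *)
Definition candidates : seq L :=
  [seq iter i phi r | i <- index_iota 0 N, r <- rs].

Definition chosen_preimage x := nth 0 candidates (find (fun y => phi y == x) candidates).

(** By [iter_minus_dvd] some [r] in [rs] satisfies [phi^(N-n) r = x]; the iterate just before the
    last is a preimage of [x]. *)
Lemma chosen_preimageP n x : (n < N)%N -> iter n phi x = T -> phi (chosen_preimage x) = x.
Proof.
move=> nN xT; have nx := preimage_nonconst xT.
have := iter_minus_dvd e0 m0 b10 qstep_normal (N - n) nx xT.
rewrite subnKC ?(ltnW nN) // -iter_minus_tE (eqp_dvdr _ rsP).
move=> /root_dvd_prod_XsubC[|r rrs rr].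
  by rewrite (size_iter_minus res_neq0) // ltnS expn_gt0.
have nr := root_iter_minus_nonconst res_neq0 nx rr.
move: rr; rewrite (root_iter_minus e0 m0 b10 qstep_normal) // => /eqP xE.
apply/eqP; rewrite /chosen_preimage.
apply: (@nth_find _ 0 (fun y => phi y == x)); apply/hasP.
exists (iter (N - n).-1 phi r); last first.
  by rewrite -iterS prednK ?subn_gt0 // xE.
apply/allpairsP; exists ((N - n).-1, r); split=> //=.
by rewrite mem_index_iota; move: nN; clear; lia.
Qed.

Local Notation node := (node iota g m T chosen_preimage).

Let node_iter := node_iter m0 b10 T_nonconst chosen_preimageP.
Let node_nonconst := node_nonconst m0 b10 T_nonconst chosen_preimageP.
Let node_inj := node_inj two0 m0 b10 T_nonconst chosen_preimageP.
Let node_take := node_take m0 b10 T_nonconst chosen_preimageP.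
Let Z_node_true := Z_node_true two0 m0 b10 T_nonconst chosen_preimageP.
Let phi_node := phi_node m0 b10 T_nonconst chosen_preimageP.

Local Notation leaf := (N.-tuple bool).
Implicit Types (u : leaf) (s : gal_of E).

Let leaf_inj : injective (fun u => node u).
Proof. by move=> u u' /node_inj H; apply/val_inj/H; rewrite !size_tuple. Qed.

Definition leaves : seq L := [seq node (val u) | u <- enum {: leaf}].

Let leaves_uniq : uniq leaves.
Proof. by rewrite map_inj_uniq ?enum_uniq. Qed.

Let leaf_root u : root (iter_minus iota v N T) (node u).
Proof.
have nu : nonconst iota (node u) by apply: node_nonconst; rewrite size_tuple.
rewrite (root_iter_minus e0 m0 b10 qstep_normal) //.
by have := @node_iter u; rewrite size_tuple => ->.
Qed.

(** The polynomial has degree [2 ^ N], and the leaves already provide that many distinct roots. *)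
Let leafP y : iter N phi y = T -> exists u : leaf, node u = y.
Proof.
move=> yT; have ny := preimage_nonconst yT.
have F0 : iter_minus iota v N T != 0.
  by rewrite -size_poly_eq0 (size_iter_minus res_neq0) //; apply: T_nonconst.
have lr : all (root (iter_minus iota v N T)) leaves.
  apply/allP => _ /mapP[u _ ->]; apply: leaf_root.
suff /mapP[u _ ->] : y \in leaves by exists u.
apply: contraT => yn.
have /(max_poly_roots F0) : all (root (iter_minus iota v N T)) (y :: leaves).
  by rewrite /= lr andbT (root_iter_minus e0 m0 b10 qstep_normal) // yT.
rewrite /= yn leaves_uniq => /(_ isT).
rewrite (size_iter_minus res_neq0); last exact: T_nonconst.
by rewrite size_map -cardE card_tuple card_bool ltnn.
Qed.

Lemma galois_splitting : galois 1%AS E.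
Proof.
apply/splitting_galoisField; exists (map_poly (in_alg L) (iter_minus_t v N)).
split; [exact: alg_polyOver| | exact: splitE].
rewrite iter_minus_tE (@all_roots_prod_XsubC _ (iter_minus iota v N T) leaves).
- rewrite (eqp_separable (eqp_scale _ _)) ?separable_prod_XsubC //.
  rewrite lead_coef_eq0 -size_poly_eq0 (size_iter_minus res_neq0) //.
  exact: T_nonconst.
- rewrite (size_iter_minus res_neq0); last exact: T_nonconst.
  by rewrite size_map -cardE card_tuple card_bool.
- apply/allP => _ /mapP[u _ ->]; apply: leaf_root.
by rewrite uniq_rootsE.
Qed.

Let gal_iota s a : s (iota a) = iota a.
Proof. by rewrite iotaE rmorph_alg. Qed.

Let gal_T s : s T = T.
Proof. by rewrite TE rmorph_alg. Qed.

Let gal_phi s y : s (phi y) = phi (s y).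
Proof.
rewrite /nphi /nden rmorphD fmorph_div.
by rewrite !expr2 !(rmorphB, rmorphD, rmorphM) /= !gal_iota.
Qed.

Let gal_iter s n y : s (iter n phi y) = iter n phi (s y).
Proof. by elim: n => //= n IH; rewrite gal_phi IH. Qed.

Let gal_Z s y : s (Z y) = Z (s y).
Proof. by rewrite /nZ fmorph_div rmorphB /= !gal_iota. Qed.

(** The default is never taken: a conjugate of a leaf still solves [phi^N y = T], hence is a
    leaf. *)
Definition gal_act s u : leaf := odflt u [pick u' : leaf | node u' == s (node u)].

Let node_act s u : node (gal_act s u) = s (node u).
Proof.
rewrite /gal_act; case: pickP => [u' /eqP //|none].
have [|u' Eu'] := @leafP (s (node u)); last by move: (none u'); rewrite Eu' eqxx.
by rewrite -gal_iter; have := @node_iter u; rewrite size_tuple => ->.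
Qed.

Lemma gal_act_inj s : injective (gal_act s).
Proof.
move=> u u' E'; have := node_act s u.
by rewrite E' node_act => /fmorph_inj/leaf_inj ->.
Qed.

Definition gal_perm s : {perm leaf} := perm (@gal_act_inj s).

Let node_perm s u : node (gal_perm s u) = s (node u).
Proof. by rewrite permE node_act. Qed.

(** The ancestor at level [i] is the image under [phi^(N-i)], and [s] commutes with [phi], whose
    coefficients lie in [k]. *)
Let node_take_perm s u i : (i <= N)%N ->
  node (take i (gal_perm s u)) = s (node (take i u)).
Proof.
move=> iN; rewrite -!node_take ?size_tuple //.
by rewrite node_perm gal_iter.
Qed.

Lemma gal_perm_tree_aut s : gal_perm s \in tree_aut N.
Proof.
apply/tree_autP => u u' i iN.
have inj (x y : leaf) : (take i x == take i y) = (node (take i x) == node (take i y)).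
  apply/eqP/eqP => [-> //|/node_inj H]; apply: H; rewrite !size_takel ?size_tuple //.
by rewrite !inj !node_take_perm // (inj_eq (fmorph_inj s)).
Qed.

Let leaf_mem u : node u \in E.
Proof.
have := leaf_root u; rewrite -iter_minus_tE (eqp_root rsP) root_prod_XsubC -rsE.
exact: seqv_sub_adjoin.
Qed.

Let iota_mem a : iota a \in E.
Proof. by rewrite iotaE rpredZ ?mem1v. Qed.

Let phi_mem y : y \in E -> phi y \in E.
Proof.
move=> yE; have yg : y - iota g \in E by rewrite rpredB ?iota_mem.
have dE : den y \in E by rewrite /nden !rpredD ?rpredM ?rpredX ?iota_mem.
by rewrite /nphi rpredD ?rpred_div ?rpredM ?rpredX ?iota_mem.
Qed.

Let node_mem w : (size w <= N)%N -> node w \in E.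
Proof.
move=> wN; rewrite -(take_pad wN) -(@node_take (pad N w)) ?size_tuple //.
elim: (_ - size w)%N => [|n IH]; first exact: (leaf_mem (pad N w)).
by rewrite iterS phi_mem.
Qed.

Let Z_mem y : y \in E -> Z y \in E.
Proof. by move=> yE; rewrite /nZ rpred_div ?rpredB ?iota_mem. Qed.

Lemma gal_perm_morph :
  {in 'Gal(E / 1%AS)%g &, {morph gal_perm : s t / (s * t)%g >-> (s * t)%g}}.
Proof.
move=> s t _ _; apply/permP => u; apply: leaf_inj; rewrite permM /=.
by rewrite !node_perm galM ?leaf_mem.
Qed.

Canonical gal_perm_morphism := Morphism gal_perm_morph.

Lemma gal_perm_injm : ('injm gal_perm_morphism)%g.
Proof.
apply/subsetP => s /morphpreP[_ /set1P s1]; apply/set1P/eqP/gal_eqP => y yE.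
rewrite gal_id; suff /subvP/(_ y yE)/mem_fixedFieldP[_ /(_ s (set11 s))] :
  (E <= fixedField [set s])%VS by [].
rewrite -[X in (X <= _)%VS]rsE; apply/Fadjoin_seqP; split; first exact: sub1v.
move=> r rrs; have rF : root (iter_minus iota v N T) r.
  by rewrite -iter_minus_tE (eqp_root rsP) root_prod_XsubC.
have [u <-] : exists u : leaf, node u = r.
  have nr := root_iter_minus_nonconst res_neq0 T_nonconst rF.
  by apply: leafP; apply/eqP; rewrite -(root_iter_minus e0 m0 b10 qstep_normal).
apply/fixedFieldP => [|_ /set1P->]; first exact: leaf_mem.
by rewrite -node_perm s1 perm1.
Qed.

Local Notation level_sum i :=
  (\sum_(w : i.-tuple bool) Z (node (rcons w false))).

Let natr_addb (a b : bool) : (a (+) b)%:R = a%:R + b%:R :> L.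
Proof. by case: a b => [] []; rewrite /= ?addr0 ?add0r // -[RHS]/(2%:R) twoL. Qed.

Let natr_big_addb (I : finType) (P : pred I) (F : I -> bool) :
  (\big[addb/false]_(i | P i) F i)%:R = \sum_(i | P i) (F i)%:R :> L.
Proof. exact: (big_morph (fun b : bool => b%:R : L) natr_addb). Qed.

(** The automorphism permutes level [i] and sends the [false] child of [w] to a child of the image
    of [w], the [true] one exactly when the label at [w] is set. Each such vertex adds 1. *)
Lemma gal_level_sum s i : (i < N)%N ->
  s (level_sum i) = level_sum i +
    (\big[addb/false]_(w : i.-tuple bool) label (gal_perm s) w)%:R.
Proof.
move=> iN; have iN' := ltnW iN.
pose rho (w : i.-tuple bool) : i.-tuple bool :=
  insubd w (take i (gal_perm s (pad N w))).
have rhoE w : rho w = take i (gal_perm s (pad N w)) :> seq bool.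
  by rewrite val_insubd size_takel ?size_tuple ?eqxx.
have rho_inj : injective rho.
  move=> w w' /(congr1 val) /=; rewrite !rhoE => /eqP.
  have /tree_autP <- // := gal_perm_tree_aut s.
  by rewrite -{1}(size_tuple w) -{3}(size_tuple w') !take_pad ?size_tuple // => /eqP/val_inj.
rewrite natr_big_addb rmorph_sum /= [X in _ = X + _](reindex_inj rho_inj) /= -big_split /=.
apply: eq_bigr => w _; rewrite gal_Z.
have -> : rcons w false = take i.+1 (pad N w).
  rewrite (take_nth false) ?size_tuple // nth_pad // [nth _ _ i]nth_default ?size_tuple //.
  by rewrite -{2}(size_tuple w) take_pad ?size_tuple.
rewrite -node_take_perm // (take_nth false) ?size_tuple // -rhoE.
rewrite /label size_tuple; case: (nth _ _ _); last by rewrite addr0.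
by rewrite Z_node_true // size_tuple.
Qed.

Let artin_schreierD : {morph (fun y : L => y ^+ 2 + y) : x y / x + y}.
Proof.
move=> x y; have -> : (x + y) ^+ 2 + (x + y) =
  x ^+ 2 + x + (y ^+ 2 + y) + 2%:R * (x * y) by ring.
by rewrite twoL mul0r addr0.
Qed.

Let artin_schreier0 : 0 ^+ 2 + 0 = 0 :> L.
Proof. by rewrite expr0n addr0. Qed.

(** In characteristic 2 the map [Z ^+ 2 + Z] is additive, so the equations at the vertices add up;
    [sum_inv_node], started at [o 0 = c], evaluates the sum. The orbit does not return to [c],
    whence [B != 0]. *)
Lemma level_sum_artin_schreier i : (i < N)%N -> exists A B : k, B != 0 /\
  level_sum i ^+ 2 + level_sum i = iota A + iota B / (T - iota (o i)).
Proof.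
move=> iN; have iN' := ltnW iN.
have := @sum_inv_node _ _ iota two0 _ _ _ _ _ _ e0 m0 b10 _ _ _ T_nonconst chosen_preimageP o
   (fun j jN => (o_step jN).1) (fun j jN => (o_step jN).2) i 0.
rewrite add0n => /(_ iN')[A [B [DAB B0]]].
have {}B0 : B != 0.
  apply: B0 => j /andP[j0 ji]; rewrite -o0 eq_sym o_inj // j0 /=.
  exact: leq_trans iN'.
rewrite o0 in DAB.
exists (m * e / b1 * A - (m * b2 / b1) *+ #|{: i.-tuple bool}|), (m * e / b1 * B).
split; first by rewrite !mulf_neq0 ?invr_eq0.
rewrite (big_morph _ artin_schreierD artin_schreier0).
rewrite (eq_bigr (fun w : i.-tuple bool =>
  iota (m * e / b1) * (node w - iota c)^-1 - iota (m * b2 / b1))).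
  rewrite sumrB -mulr_sumr DAB sumr_const rmorphB rmorphMn !rmorphM /= mulrDr.
  by rewrite addrAC mulrA.
move=> w _; have wN : (size w < N)%N by rewrite size_tuple.
have ny : nonconst iota (node (rcons w false)).
  by apply: node_nonconst; rewrite size_rcons.
rewrite (@nZ_artin_schreier _ (iota c) (iota e) _ _ (iota b1) (iota b2)) ?phi_node //.
- by rewrite !(rmorphM, fmorphV).
- by rewrite fmorph_eq0.
- by rewrite fmorph_eq0.
- by rewrite subr_eq0; apply/eqP/ny.
by apply: nonconst_den.
Qed.

(** If the sum were some [h] in [k(t)], then [h ^+ 2 + h] would be a constant plus simple poles at
    distinct points [o i], with a nonzero coefficient at [o i0]. *)
Lemma level_sums_independent (J : pred 'I_N) i0 : J i0 ->
  \sum_(i | J i) level_sum (i : 'I_N) \notin 1%VS.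
Proof.
move=> Ji0; apply/vlineP => -[h Sh].
have /fin_all_exists[A] : forall i : 'I_N, exists A : k, exists B : k, B != 0 /\
  level_sum i ^+ 2 + level_sum i = iota A + iota B / (T - iota (o i)).
  by move=> i; apply: level_sum_artin_schreier.
move=> /fin_all_exists[B AB].
pose y (i : 'I_N) : kt k := tofrac (A i)%:P + tofrac (B i)%:P / (tofrac 'X - tofrac (o i)%:P).
apply: (@artin_schreier_simple_pole k (o i0) (B i0)
  (tofrac (A i0)%:P + \sum_(i | J i && (i != i0)) y i) h).
- by have [] := AB i0.
- apply: regular_atD; first exact: regular_at_const.
  apply: (big_ind (regular_at (o i0))) => [||i /andP[_ ii0]].
  + by have := regular_at_const (o i0) 0; rewrite tofrac0.
  + exact: regular_atD.
  apply: regular_atD; first exact: regular_at_const.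
  apply: regular_at_pole.
  case: (ltngtP i i0) ii0 => [lt _|lt _|/val_inj -> /eqP//].
    by rewrite eq_sym o_inj // lt ltnW.
  by rewrite o_inj // lt ltnW.
have [ia iaE] : exists ia : {rmorphism kt k -> L}, forall x, ia x = x%:A.
  by exists (in_alg L).
apply: (fmorph_inj ia); transitivity (ia (\sum_(i | J i) y i)); last first.
  by rewrite (bigD1 i0 Ji0) /= /y; congr (ia _); rewrite addrAC addrC addrA.
rewrite rmorphD rmorphXn [ia h]iaE -Sh (big_morph _ artin_schreierD artin_schreier0).
rewrite rmorph_sum; apply: eq_bigr => i _; have [_ ->] := AB i.
by rewrite /y rmorphD [RHS]/= [X in _ = _ + X]fmorph_div rmorphB TE !iotaE !iaE.
Qed.

(** On a proper image a nonempty sum of level signs vanishes. The matching sum of the [level_sum]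
    elements is then fixed by the Galois group and lies in [k(t)], against
    [level_sums_independent]. *)
Lemma gal_perm_image : (gal_perm_morphism @* 'Gal(E / 1%AS) = tree_aut N)%g.
Proof.
have sub : (gal_perm_morphism @* 'Gal(E / 1%AS) \subset tree_aut N)%g.
  by apply/subsetP => _ /morphimP[s _ _ ->]; apply: gal_perm_tree_aut.
apply/eqP; rewrite eqEsubset sub /=; apply: contraT => nsub.
have /proper_subgroup_level_signs[J [i0 Ji0] HJ] :
  (gal_perm_morphism @* 'Gal(E / 1%AS) \proper tree_aut N)%g by rewrite properE sub.
have : \sum_(i | J i) level_sum (i : 'I_N) \in fixedField 'Gal(E / 1%AS)%g.
  apply/fixedFieldP => [|s Gs].
    apply: rpred_sum => i _; apply: rpred_sum => w _; apply: Z_mem.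
    by apply: node_mem; rewrite size_rcons size_tuple.
  rewrite rmorph_sum /= (eq_bigr _ (fun i _ => gal_level_sum s (ltn_ord i))) big_split /=.
  rewrite -[RHS]addr0; congr (_ + _); rewrite -natr_big_addb big_mkcond /=.
  have := HJ (gal_perm s) (mem_morphim gal_perm_morphism Gs Gs).
  rewrite (eq_bigr (fun i : 'I_N =>
    if J i then \big[addb/false]_(w : i.-tuple bool) label (gal_perm s) w else false)).
    by move=> ->.
  by move=> i _; case: (J i).
by rewrite (galois_fixedField galois_splitting) (negPf (level_sums_independent Ji0)).
Qed.

Lemma gal_isog_tree_aut : ('Gal(E / 1%AS) \isog tree_aut N)%g.
Proof.
apply/isogP; exists gal_perm_morphism; first exact: gal_perm_injm.
exact: gal_perm_image.
Qed.

End Roots.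
End Normalized.
End FunctionFieldTower.

(** * The open set and the Galois groups over it *)

Theorem theorem5p1 (k : closedFieldType) (chark : 2%N \in [pchar k]) (N : nat) :
  exists S : seq (mpoly.mpoly 6 k),
    (exists v : 'I_6 -> k, inRat2 v /\ in_open S v) /\
    (forall v : 'I_6 -> k, inRat2 v -> in_open S v ->
       forall (L : splittingFieldType (kt k)) (E : {subfield L}),
         splittingFieldFor 1%VS (map_poly (in_alg L) (iter_minus_t v N)) E ->
         ('Gal(E / 1%AS) \isog tree_aut N)%g).
Proof.
have two0 : 2%:R = 0 :> k := pcharf0 chark.
have openE (v : 'I_6 -> k) : in_open [:: generic_mpoly N k] v = (generic N v != 0) :> Prop.
  by rewrite /in_open /= orbF meval_generic.
exists [:: generic_mpoly N k]; split; last first.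
  move=> v [res0 _]; rewrite openE => v_generic L E splitE.
  have [det0 D _] := generic_neq0 v_generic.
  have b10 : v (inord 4) != 0 := D 0 (leq0n N).
  have [c [e [g [m [b1 [b2 [e0 m0 b10' Dc nf]]]]]]] :=
    normal_form_exists two0 res0 b10 det0.
  pose iota : {rmorphism k -> L} :=
    GRing.in_alg L \o (@FracField.tofrac {poly k}) \o polyC.
  have [rs rsP rsE] := splitE.
  exact: (gal_isog_tree_aut two0 res0 v_generic splitE (iota := iota)
    (fun a => erefl) erefl e0 m0 b10' Dc (nf L iota) rsP rsE).
(* The factor ['X] makes the parameter [s] nonzero, which gives [a_2 != 0] and a nonzero
   resultant. *)
have nz : ('X : {poly k}) * generic N (example ('X : {poly k})) != 0.
  by rewrite mulf_neq0 ?polyX_eq0 ?generic_example_neq0.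
have [s] := closed_nonrootP _ nz; rewrite rootM negb_or => /andP[s0 sG].
have exE : generic N (example s) = (generic N (example ('X : {poly k}))).[s].
  rewrite -[RHS]/(horner_eval s _) -generic_morph; apply: eq_generic => i.
  rewrite /example /horner_eval /=.
  by case: i => -[|[|[|[|[|[|//]]]]]] /= ?; rewrite /horner_eval !hornerE.
have {}s0 : s != 0 by move: s0; rewrite /root hornerX.
exists (example s); rewrite openE exE; split=> //; split; last first.
  by left; rewrite /coef_a /example !inordK.
(* The columns of the Sylvester matrix successively kill the coordinates of a left kernel vector. *)
apply/det0P => -[x x0 xS]; case/negP: x0; apply/eqP/rowP.
have col j : \sum_i x 0 i * sylv22 (example s) i j = 0.
  by have := congr1 (fun y : 'rV_4 => y 0 j) xS; rewrite !mxE.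
move: (col ord0) (col (inord 1)) (col (inord 2)) (col (inord 3)).
rewrite !big_ord_recl !big_ord0 !mxE !inordK //=.
rewrite /coef_a /coef_b /example /bump /=.
rewrite ?(add1n, addn0, subSS, sub0n, subn0, addSn, add0n, subnn) !inordK //=.
set y0 := x 0 ord0; set y1 := x 0 (lift (ord0 : 'I_4) (ord0 : 'I_3)).
set y2 := x 0 (lift (ord0 : 'I_4) (lift (ord0 : 'I_3) (ord0 : 'I_2))).
set y3 := x 0 (lift (ord0 : 'I_4) (lift (ord0 : 'I_3) (lift (ord0 : 'I_2) (ord0 : 'I_1)))).
move=> E0 E1 E2 E3.
have Y1 : y1 = 0 by rewrite -E3; ring.
have Y0 : y0 = 0.
  have /eqP : y0 * s = 0 by rewrite -[RHS]E0; ring.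
  by rewrite mulf_eq0 (negPf s0) orbF => /eqP.
have Y2 : y2 = 0 by rewrite -E1 Y0 Y1; ring.
have Y3 : y3 = 0 by rewrite -E2 Y0 Y1; ring.
move=> j; rewrite mxE; case: j => -[|[|[|[|//]]]] lt_j.
- by rewrite -[RHS]Y0; congr (x 0 _); apply: val_inj.
- by rewrite -[RHS]Y1; congr (x 0 _); apply: val_inj.
- by rewrite -[RHS]Y2; congr (x 0 _); apply: val_inj.
- by rewrite -[RHS]Y3; congr (x 0 _); apply: val_inj.
Qed.
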